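(* Let $\alpha \in \left(0,\frac{1}{2}\right) \cup \left(\frac{1}{2},\frac{3}{5}\right)$ be a constant, let $p_n = n^{-\alpha}$, and let $G \sim G(n,p_n)$. Then with high probability $G$ is exactly reconstructable from its $2$-neighborhoods; that is, the probability that every graph $H$ on the vertex set $[n]$ with $G \sim_2 H$ satisfies $H = G$ tends to $1$ as $n \to \infty$. Moreover, when $\alpha < \frac{1}{2}$ there is an efficient (polynomial-time in $n$) algorithm which, given the collection of $2$-neighborhoods of $G$ (with labeled centers and all other vertices unlabeled), outputs the labeled graph $G$ with high probability.
   Context: All graphs are simple and undirected, with labeled vertex set $V = [n] = \{1,\dots,n\}$. $G(n,p_n)$ is the Erdős–Rényi random graph on $[n]$: each pair of distinct vertices is an edge independently with probability $p_n$. ''With high probability'' means with probability tending to $1$ as $n \to \infty$. For a vertex $v$ of a graph $G$, $\mathcal{N}_r(v)$ is the subgraph of $G$ induced by all vertices at graph distance at most $r$ from $v$. For each $v \in V$ one observes $\mathcal{N}_r(v)$ with the central vertex $v$ labeled and all other vertices unlabeled. For two graphs $H_1, H_2$ on $V$, write $H_1 \sim_r H_2$ (they have the same $r$-neighborhoods) if for every $v \in V$ the $r$-neighborhood of $v$ in $H_1$ is isomorphic to the $r$-neighborhood of $v$ in $H_2$ (by an isomorphism fixing the labeled center $v$). $G$ is exactly reconstructable from its $r$-neighborhoods if $G$ itself as a labeled graph (not only up to isomorphism) is determined by this collection, i.e. every graph $H$ on $V$ with $G \sim_r H$ satisfies $H = G$. *)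

(* Defs.v *)
From HB Require Import structures.
From mathcomp Require Import all_boot all_order all_algebra.
From mathcomp Require Import all_classical all_reals all_analysis.

Set Implicit Arguments.
Unset Strict Implicit.
Unset Printing Implicit Defensive.

Import Order.TTheory GRing.Theory Num.Theory.
Import numFieldNormedType.Exports.

Record sgraph (T : finType) := SGraph {
  edges : {set {set T}};
  edges_card2 : [forall e in edges, #|e| == 2]
}.

HB.instance Definition _ (T : finType) := [isSub for @edges T].
HB.instance Definition _ (T : finType) := [Finite of sgraph T by <:].

Definition adj (T : finType) (G : sgraph T) : rel T :=
  [rel x y | [set x; y]%SET \in edges G].

Lemma induced_card2 (T : finType) (G : sgraph T) (A : {set T}) :
  [forall e in [set e : {set {x | x \in A}} | (val @: e)%SET \in edges G]%SET,
    #|e| == 2].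
Proof.
apply/forall_inP => e; rewrite inE => he.
rewrite -(card_imset (mem e) val_inj).
exact: (forall_inP (edges_card2 G)).
Qed.

Definition induced (T : finType) (G : sgraph T) (A : {set T}) :
  sgraph {x | x \in A} := SGraph (induced_card2 G A).

(* Vertices at graph distance at most r from v: endpoints of walks of length
   k <= r starting at v. *)
Definition gball (T : finType) (G : sgraph T) (r : nat) (v : T) : {set T} :=
  [set u | [exists k : 'I_r.+1, [exists p : k.-tuple T,
     path (adj G) v p && (last v p == u)]]]%SET.

Lemma gball_center (T : finType) (G : sgraph T) (r : nat) (v : T) :
  v \in gball G r v.
Proof.
rewrite inE; apply/existsP; exists ord0; apply/existsP; exists [tuple].
by rewrite /= eqxx.
Qed.

Record rooted_graph := RootedGraph {
  rvertex : finType;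
  rgraph : sgraph rvertex;
  rroot : rvertex
}.

Definition rooted_iso (A B : rooted_graph) : Prop :=
  exists f : rvertex A -> rvertex B,
    [/\ bijective f,
        forall x y, adj (rgraph B) (f x) (f y) = adj (rgraph A) x y
      & f (rroot A) = rroot B].

Definition nbhd (T : finType) (r : nat) (G : sgraph T) (v : T) : rooted_graph :=
  RootedGraph (induced G (gball G r v)) (exist _ v (gball_center G r v)).

Definition same_nbhds (T : finType) (r : nat) (H1 H2 : sgraph T) : Prop :=
  forall v, rooted_iso (nbhd r H1 v) (nbhd r H2 v).

Definition exactly_reconstructable (T : finType) (r : nat) (G : sgraph T) :
  Prop := forall H : sgraph T, same_nbhds r G H -> H = G.

(* Probability of the event E under G(n, p): every 2-subset of the vertex set
   is an edge independently with probability p. *)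
Definition Gnp_prob (R : realType) (n : nat) (p : R)
    (E : sgraph 'I_n -> Prop) : R :=
  (\sum_(G : sgraph 'I_n | `[< E G >])
     \prod_(e : {set 'I_n} | #|e| == 2) (if e \in edges G then p else 1 - p))%R.

(* Model of computation: structured programs for a unit-cost random access
   machine whose only arithmetic is addition and truncated subtraction, so that
   polynomial running time agrees with polynomial time on a Turing machine.
   The memory consists of registers and of one-dimensional arrays; since array
   names are literals, a program uses only finitely many arrays. *)
Inductive expr :=
  | Const of nat
  | Reg of nat
  | Get of nat & expr
  | Plus of expr & expr
  | Minus of expr & expr.

Inductive cmd :=
  | Skip
  | Assign of nat & expr
  | Put of nat & expr & expr
  | Seq of cmd & cmd
  | If of expr & cmd & cmd
  | While of expr & cmd.

Record state := State { regs : nat -> nat; arrays : nat -> nat -> nat }.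

Fixpoint eval (s : state) (e : expr) : nat :=
  match e with
  | Const k => k
  | Reg x => regs s x
  | Get a e1 => arrays s a (eval s e1)
  | Plus e1 e2 => eval s e1 + eval s e2
  | Minus e1 e2 => eval s e1 - eval s e2
  end.

Fixpoint cost (e : expr) : nat :=
  match e with
  | Const _ | Reg _ => 1
  | Get _ e1 => (cost e1).+1
  | Plus e1 e2 | Minus e1 e2 => (cost e1 + cost e2).+1
  end.

Definition set_reg (s : state) (x k : nat) : state :=
  State (fun y => if y == x then k else regs s y) (arrays s).

Definition set_cell (s : state) (a i k : nat) : state :=
  State (regs s)
    (fun b j => if (b == a) && (j == i) then k else arrays s b j).

(* [exec c s t s']: started in state s, c halts in state s' after t steps.
   Tests succeed on nonzero values. *)
Inductive exec : cmd -> state -> nat -> state -> Prop :=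
  | exec_skip s : exec Skip s 1 s
  | exec_assign s x e :
      exec (Assign x e) s (cost e).+1 (set_reg s x (eval s e))
  | exec_put s a e1 e2 :
      exec (Put a e1 e2) s (cost e1 + cost e2).+1
        (set_cell s a (eval s e1) (eval s e2))
  | exec_seq c1 c2 s1 t1 s2 t2 s3 :
      exec c1 s1 t1 s2 -> exec c2 s2 t2 s3 ->
      exec (Seq c1 c2) s1 (t1 + t2).+1 s3
  | exec_if_true e c1 c2 s t s' :
      eval s e <> 0 -> exec c1 s t s' ->
      exec (If e c1 c2) s (cost e + t).+1 s'
  | exec_if_false e c1 c2 s t s' :
      eval s e = 0 -> exec c2 s t s' ->
      exec (If e c1 c2) s (cost e + t).+1 s'
  | exec_while_true e c s1 t1 s2 t2 s3 :
      eval s1 e <> 0 -> exec c s1 t1 s2 -> exec (While e c) s2 t2 s3 ->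
      exec (While e c) s1 (cost e + t1 + t2).+1 s3
  | exec_while_false e c s :
      eval s e = 0 -> exec (While e c) s (cost e).+1 s.

Lemma exec_det c s t1 s1 t2 s2 :
  exec c s t1 s1 -> exec c s t2 s2 -> t1 = t2 /\ s1 = s2.
Proof.
move=> h; elim: h t2 s2 => {c s t1 s1}; intros;
  match goal with h : exec _ _ ?t ?s |- _ = ?t /\ _ = ?s =>
    inversion h; subst end => //;
  repeat match goal with
  | IH : (forall t s, exec ?c ?s1 t s -> _), h : exec ?c ?s1 _ _ |- _ =>
      have [? ?] := IH _ _ h; subst; clear h
  end => //.
Qed.

(* A rooted graph as handed to an algorithm: its vertices carry arbitrary names
   0, ..., m - 1, unrelated to the labels of the graph it was taken from. *)
Record numbered_graph := NumberedGraph {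
  nsize : nat;
  ngraph : sgraph 'I_nsize;
  nroot : 'I_nsize
}.

Definition rooted_of_numbered (X : numbered_graph) : rooted_graph :=
  RootedGraph (ngraph X) (nroot X).

(* [X v] is some naming of the r-neighborhood of v: the center is known to be v
   because of its position v in the family, the other vertices are anonymous. *)
Definition presents (n r : nat) (G : sgraph 'I_n) (X : 'I_n -> numbered_graph) :
  Prop := forall v, rooted_iso (nbhd r G v) (rooted_of_numbered (X v)).

Definition adj_matrix_seq (m : nat) (G : sgraph 'I_m) : seq nat :=
  [seq nat_of_bool (adj G i j) | i <- enum 'I_m, j <- enum 'I_m].

Definition encode_numbered (X : numbered_graph) : seq nat :=
  [:: nsize X, nat_of_ord (nroot X) & adj_matrix_seq (ngraph X)].

Definition encode (n : nat) (X : 'I_n -> numbered_graph) : seq nat :=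
  n :: flatten [seq encode_numbered (X v) | v <- enum 'I_n].

(* The input occupies an initial segment of array 0; all other cells and all
   registers initially hold 0. *)
Definition init_state (w : seq nat) : state :=
  State (fun _ => 0) (fun a i => if a == 0 then nth 0 w i else 0).

(* The output is the adjacency matrix, in row-major order, in array 1. *)
Definition outputs (n : nat) (s : state) (G : sgraph 'I_n) : Prop :=
  forall i j : 'I_n, arrays s 1 (i * n + j) = nat_of_bool (adj G i j).

(* P halts after a number of steps polynomial in n on the collection of
   r-neighborhoods of every graph on n labeled vertices. *)
Definition polytime_on_nbhds (r : nat) (P : cmd) : Prop :=
  exists c k : nat, forall (n : nat) (G : sgraph 'I_n)
      (X : 'I_n -> numbered_graph), presents r G X ->
    exists t s, exec P (init_state (encode X)) t s /\ t <= c * n ^ k + c.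

(* P recovers G from its r-neighborhoods, however these are presented. *)
Definition reconstructs (n r : nat) (P : cmd) (G : sgraph 'I_n) : Prop :=
  forall X : 'I_n -> numbered_graph, presents r G X ->
    exists t s, exec P (init_state (encode X)) t s /\ outputs s G.

(* Main.v *)
Require Import Defs.
From mathcomp Require Import all_boot all_order all_algebra.
From mathcomp Require Import all_classical all_reals all_analysis.
From mathcomp Require Import ssrnat seq fintype finset.
From mathcomp Require Import lra ring zify.
Import Order.TTheory GRing.Theory Num.Theory.
Import numFieldNormedType.Exports.

Set Implicit Arguments.
Unset Strict Implicit.
Unset Printing Implicit Defensive.

(** The two ranges of [alpha] call for different reasons.

    For [alpha < 1/2] the graph has diameter 2, so each neighbourhood is an
    unlabelled copy of the whole graph, and what has to be recovered is the
    labels.  The invariant used is, for a vertex [x], the number of neighbours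
    of [x] of each degree ([nbr_degs]); call the graph [separated] when any two
    vertices have a common neighbour and this invariant tells all vertices apart.  In a
    separated graph every isomorphism with another graph is forced on each
    vertex, so the graph is reconstructable ([separated_reconstructable]); and a
    program can find vertex [j] in the copy rooted at [i] by comparing
    invariants with the root of the copy at [j] ([program_reconstructs]).
    The graph is separated with high probability ([separated_whp]): a given
    pair of vertices has the same degree with probability at most a negative
    power of [n], because the binomial law does not concentrate on a point
    ([binomial_pmf_le]), hence no degree is shared by more than a power
    [n^(31/32)] of the vertices ([deg_class_upper]).  Fix [x], [x'] and reveal
    all edges avoiding both.  The degrees inside the rest of the graph cut the
    other vertices into classes, each of at most three times that size, and if
    [x] and [x'] have the same invariant then they have equally many
    neighbours in every class.  Already the equality of parities in all
    classes, which are independent events, has a probability exponentially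
    small in [n^(1/32)] ([nbr_degs_eq_le]).

    For [1/2 < alpha < 3/5] the neighbourhoods are much smaller than the graph
    and have to be compared where they overlap.  Let [H] have the same
    neighbourhoods as [G], let [vw] be an edge of [G], and let [w'] be the
    image of [w] under an isomorphism of the balls at [v] in [G] and [H].
    Following it by an isomorphism of the balls at [w'] in [H] and [G] yields
    a partial isomorphism of [G] which takes [w] to [w'] and is defined on all
    vertices near [v] that are joined to [w] by a walk of length 2
    ([overlap]).  If [w'] differed from [w], it would move nearly all of them,
    because degrees are below [n^(1/2)] and codegrees are bounded.  But there
    are about [n^(3-4 alpha)] such vertices ([overlap_lower]), while with high
    probability no two disjoint sets of [n^(alpha+eps)] vertices are related
    by an isomorphism ([twin_free_likely]); and [3-4 alpha > alpha] exactly
    when [alpha < 3/5].  So [w'] is [w], every neighbour of [v] in [G] is one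
    in [H], and the graphs agree ([reconstructable_of_overlap]).

    All probabilities are computed in the product measure on sets of edge
    slots, where conditioning on some of the edges takes the form of
    resampling the others ([Ex_resample]). *)

(** * Graphs and edge slots *)

Section Graphs.
Context {T : finType}.

Lemma graph_of_card2 (w : {set {set T}}) :
  [forall e in [set e : {set T} in w | #|e| == 2%N], #|e| == 2%N].
Proof. by apply/forall_inP => e; rewrite inE => /andP[]. Qed.

(** Any set of sets of vertices is read as a graph by keeping its pairs, so that
    random graphs can live on the product space of all sets of sets, without a
    subtype. *)
Definition graph_of (w : {set {set T}}) : sgraph T := SGraph (graph_of_card2 w).

Lemma adj_graph_of w x y :
  adj (graph_of w) x y = (x != y) && ([set x; y]%SET \in w).
Proof. by rewrite /adj /= inE cards2 andbC; case: (x != y). Qed.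

Lemma edges_inj : injective (@edges T).
Proof. by move=> G H e; apply: val_inj. Qed.

Lemma graph_of_edges (G : sgraph T) : graph_of (edges G) = G.
Proof.
apply: edges_inj; apply/setP => e; rewrite inE andbC.
by case eG: (e \in edges G); rewrite ?andbF ?andbT // (forall_inP (edges_card2 G)).
Qed.

Lemma adj_sym (G : sgraph T) x y : adj G x y = adj G y x.
Proof. by rewrite /adj /= finset.setUC. Qed.

Lemma adj_irr (G : sgraph T) x : adj G x x = false.
Proof. by rewrite -(graph_of_edges G) adj_graph_of eqxx. Qed.

Lemma adj_neq (G : sgraph T) x y : adj G x y -> x != y.
Proof. by apply: contraTneq => ->; rewrite adj_irr. Qed.

Lemma adj_ext (G H : sgraph T) : (forall x y, adj G x y = adj H x y) -> G = H.
Proof.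
move=> GH; apply: edges_inj; apply/setP => e.
have [/cards2P[x [y [xy ->]]]|e2] := boolP (#|e| == 2%N); first exact: GH.
by apply/idP/idP => /(forall_inP (edges_card2 _)); rewrite (negPf e2).
Qed.

End Graphs.

Section Slots.
Context {T : finType}.
Implicit Types x y u v : T.

Definition slot x y : {set T} := [set x; y]%SET.

Lemma slotC x y : slot x y = slot y x.
Proof. exact: finset.setUC. Qed.

Lemma card_slot x y : x != y -> #|slot x y| == 2%N.
Proof. by rewrite cards2 => ->. Qed.

Lemma slot_eq x y u v : x != y ->
  (slot x y == slot u v) = ((x == u) && (y == v)) || ((x == v) && (y == u)).
Proof.
move=> xy; apply/eqP/idP => [e|]; last first.
  by case/orP => /andP[/eqP-> /eqP->] //; rewrite slotC.
have xi : x \in slot u v by rewrite -e !inE eqxx.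
have yi : y \in slot u v by rewrite -e !inE eqxx orbT.
have ui : u \in slot x y by rewrite e !inE eqxx.
have vi : v \in slot x y by rewrite e !inE eqxx orbT.
move: xi yi ui vi xy; rewrite !inE => /orP[]/eqP-> /orP[]/eqP-> _ _;
by rewrite !eqxx ?orbT.
Qed.

Lemma slot_inj x i j : (slot x i == slot x j) = (i == j).
Proof.
apply/eqP/eqP => [e|->//]; apply/eqP.
have : i \in slot x j by rewrite -e !inE eqxx orbT.
have : j \in slot x i by rewrite e !inE eqxx orbT.
by rewrite !inE => /orP[/eqP->|/eqP->]; rewrite ?orbb // => /orP[].
Qed.

Lemma slot_neq x y u v : x != u -> x != v -> slot x y != slot u v.
Proof.
move=> xu xv; apply: contraTneq isT => e.
have : x \in slot u v by rewrite -e !inE eqxx.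
by rewrite !inE (negPf xu) (negPf xv).
Qed.

End Slots.

(** * Reconstruction from overlapping neighbourhoods *)

Section Deterministic.
Context {T : finType}.
Implicit Types (G H : sgraph T) (x y v w : T).

Definition nbrs G x : {set T} := [set y | adj G x y].
Definition conbrs G x y : {set T} := nbrs G x :&: nbrs G y.

Lemma in_nbrs G x y : (y \in nbrs G x) = adj G x y.
Proof. by rewrite inE. Qed.

Lemma gball2E G v x : (x \in gball G 2 v) =
  [|| x == v, adj G v x | [exists a, adj G v a && adj G a x]].
Proof.
rewrite inE; apply/existsP/or3P.
- case=> -[[|[|[|k]]] //= kr] /existsP[p /andP[]].
  + by rewrite (tuple0 p) /= => _ /eqP->; apply: Or31.
  + case/tupleP: p => a p; rewrite (tuple0 p) /= andbT => va /eqP <-.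
    exact: Or32.
  + case/tupleP: p => a p; case/tupleP: p => b p; rewrite (tuple0 p) /= andbT.
    by move=> /andP[va ab] /eqP <-; apply: Or33; apply/existsP; exists a; rewrite va.
- case=> [/eqP ->|vx|/existsP[a /andP[va ax]]].
  + by exists ord0; apply/existsP; exists [tuple]; rewrite /= eqxx.
  + exists (Ordinal (isT : 1 < 3)%N); apply/existsP; exists [tuple x].
    by rewrite /= vx eqxx.
  + exists (Ordinal (isT : 2 < 3)%N); apply/existsP; exists [tuple a; x].
    by rewrite /= va ax eqxx.
Qed.

Lemma gball2_nbr G v w : adj G v w -> w \in gball G 2 v.
Proof. by rewrite gball2E => ->; rewrite orbT. Qed.

Lemma gball2_nbr2 G v a w : adj G v a -> adj G a w -> w \in gball G 2 v.
Proof.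
by move=> va aw; rewrite gball2E; apply/or3P/Or33/existsP; exists a; rewrite va.
Qed.

Lemma adj_induced G (A : {set T}) (a b : {x | x \in A}) :
  adj (Defs.induced G A) a b = adj G (val a) (val b).
Proof. by rewrite /adj /= inE imsetU !imset_set1. Qed.

(** The isomorphism and its inverse are extended by the identity to maps of [T],
    so that isomorphisms of different balls can be composed without transporting
    elements between subtypes. *)
Lemma nbhd_isoP r G H v : rooted_iso (nbhd r G v) (nbhd r H v) ->
  exists f g : T -> T,
    [/\ [/\ f v = v & g v = v],
        {in gball G r v, forall x, f x \in gball H r v /\ g (f x) = x},
        {in gball H r v, forall y, g y \in gball G r v /\ f (g y) = y}
      & {in gball G r v &, forall x y, adj H (f x) (f y) = adj G x y}].
Proof.
case=> /= h [[h' hK h'K] hadj hroot].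
pose f x := if insub x is Some u then val (h u) else x.
pose g y := if insub y is Some u then val (h' u) else y.
have fE (u : {x | x \in gball G r v}) : f (val u) = val (h u) by rewrite /f valK.
have gE (u : {x | x \in gball H r v}) : g (val u) = val (h' u) by rewrite /g valK.
exists f, g; split.
- have root' : h' (exist _ v (gball_center H r v)) = exist _ v (gball_center G r v).
    by rewrite -hroot hK.
  split.
    by have := fE (exist _ v (gball_center G r v)); rewrite hroot.
  by have := gE (exist _ v (gball_center H r v)); rewrite root'.
- move=> x xB; have := fE (exist _ x xB); rewrite /= => ->.
  by split; [exact: (svalP (h _))|rewrite gE hK].
- move=> x xB; have := gE (exist _ x xB); rewrite /= => ->.
  by split; [exact: (svalP (h' _))|rewrite fE h'K].
- move=> x y xB yB.
  have := fE (exist _ x xB); rewrite /= => ->.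
  have := fE (exist _ y yB); rewrite /= => ->.
  by rewrite -adj_induced hadj adj_induced.
Qed.

(** As [f] and [g] have disjoint images, the pairs inside one are independent of
    those inside the other in a random graph, and agreement in all places is
    very unlikely. *)
Definition twin_free k G := forall f g : {ffun 'I_k -> T},
  injective f -> injective g -> (forall i j, f i != g j) ->
  ~ (forall i j, adj G (f i) (f j) = adj G (g i) (g j)).

(** Take [D] maximal among the subsets of [M] disjoint from their image.  A
    vertex of [M] outside [D] cannot be added to it, so it lies in the image of
    [D] or is sent into [D]; as [phi] is injective, there are at most [#|D|]
    vertices of either kind. *)
Lemma disjoint_from_image (phi : T -> T) (M : {set T}) :
  {in M &, injective phi} -> {in M, forall x, phi x != x} ->
  exists2 D : {set T}, D \subset M &
    [disjoint D & phi @: D] /\ #|M| <= 3 * #|D|.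
Proof.
move=> inj mov.
pose ok (D : {set T}) := (D \subset M) && [disjoint D & phi @: D].
have ok0 : ok finset.set0 by rewrite /ok sub0set disjoint_sym imset0 disjoints_subset sub0set.
have [D Dmax] := maxset_exists ok0.
case: Dmax => /maxsetP[/andP[DM dis] Dmax] _.
exists D => //; split=> //.
have sub : M \subset D :|: (phi @: D :|: [set x in M | phi x \in D]).
  apply/fintype.subsetP => x xM; rewrite !inE xM /=.
  case xD: (x \in D) => //=; case xI: (x \in phi @: D) => //=.
  apply/negPn/negP => pD.
  suff : x |: D = D by move=> e; rewrite -e !inE eqxx in xD.
  apply: Dmax; last exact: finset.subsetUr.
  rewrite /ok finset.subUset sub1set xM DM /=; apply/pred0P => y; apply/negP => /=.
  case/andP; rewrite !inE => yD /imsetP[z]; rewrite !inE => zD yz.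
  have yM : y \in M by case/orP: yD => [/eqP->//|/(fintype.subsetP DM)].
  have zM : z \in M by case/orP: zD => [/eqP->//|/(fintype.subsetP DM)].
  case/orP: zD yz => [/eqP->|zD] yz.
    case/orP: yD => [/eqP yx|yD]; first by have := mov x xM; rewrite -yz yx eqxx.
    by rewrite -yz yD in pD.
  case/orP: yD => [/eqP yx|yD].
    by have : x \in phi @: D by [apply/imsetP; exists z; rewrite // -yz yx]; rewrite xI.
  have := disjointFr dis yD; rewrite yz.
  by have -> : phi z \in phi @: D by apply: imset_f.
apply: leq_trans (subset_leq_card sub) _.
have injD : {in D &, injective phi}.
  by move=> x y /(fintype.subsetP DM) xM /(fintype.subsetP DM); apply: inj.
have h1 := leq_of_leqif (leq_card_setU D (phi @: D :|: [set x in M | phi x \in D])).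
have h2 := leq_of_leqif (leq_card_setU (phi @: D) [set x in M | phi x \in D]).
have h3 : #|phi @: D| = #|D| by rewrite card_in_imset.
have h4 : #|[set x in M | phi x \in D]| <= #|D|.
  rewrite -(card_in_imset (f := phi)); last first.
    by move=> x y; rewrite !inE => /andP[xM _] /andP[yM _]; apply: inj.
  apply: subset_leq_card; apply/fintype.subsetP => y /imsetP[x].
  by rewrite inE => /andP[_ pD] ->.
lia.
Qed.

Lemma twin_free_moved k G (phi : T -> T) (M : {set T}) : twin_free k G ->
  {in M &, injective phi} -> {in M, forall x, phi x != x} ->
  {in M &, forall x y, adj G (phi x) (phi y) = adj G x y} -> #|M| < 3 * k.
Proof.
move=> tf inj mov pres; rewrite ltnNge; apply/negP => kM.
have [D DM [dis MD]] := disjoint_from_image inj mov.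
have kD : k <= #|D| by lia.
pose a (i : 'I_k) : T := enum_val (widen_ord kD i).
have aD i : a i \in D by apply: enum_valP.
have aM i : a i \in M by apply: (fintype.subsetP DM).
have ainj : injective a.
  move=> i j /enum_val_inj e; apply: val_inj.
  by move/(congr1 val): e.
apply: (tf [ffun i => a i] [ffun i => phi (a i)]).
- by move=> i j; rewrite !ffunE => /ainj.
- by move=> i j; rewrite !ffunE => /inj e; apply: ainj; apply: e.
- move=> i j; rewrite !ffunE; apply: contraTneq isT => e.
  have := disjointFr dis (aD i); rewrite e.
  by have -> : phi (a j) \in phi @: D by apply: imset_f.
- by move=> i j; rewrite !ffunE pres.
Qed.

Lemma card_bigcup_leq (I : finType) (A : {set I}) (F : I -> {set T}) (m : nat) :
  (forall i, i \in A -> #|F i| <= m) -> #|\bigcup_(i in A) F i| <= #|A| * m.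
Proof.
move=> hF; apply: (@leq_trans (\sum_(i in A) #|F i|)).
  elim/big_rec2: _ => [|i n B iA h]; first by rewrite cards0.
  by have := leq_of_leqif (leq_card_setU (F i) B); lia.
by rewrite -sum_nat_const; apply: leq_sum.
Qed.

(** When [w] is a neighbour of [v], a partial isomorphism obtained by going from
    [G] to [H] in the ball at [v] and back in the ball at the image of [w] is
    defined on these vertices. *)
Definition overlap G v w : {set T} :=
  [set x in gball G 2 v | [exists b, adj G w b && adj G b x]].

(** Suppose that [phi], as above, takes [w] to [w'] different from [w].  If it
    fixes a vertex [x] of the overlap, reached from [w] through [b], then [x]
    is a neighbour of [phi b], a neighbour of [w'].  Either [b] is fixed, and
    it is one of the at most [c] common neighbours of [w] and [w']; or [x] is
    a common neighbour of [b] and [phi b].  Each case leaves at most [c * D]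
    choices for [x].  The rest of the overlap is moved, which contradicts
    [twin_free_moved]. *)
Lemma reconstructable_of_overlap (k c D : nat) G :
  twin_free k G ->
  (forall x y, x != y -> #|conbrs G x y| <= c) ->
  (forall x, #|nbrs G x| <= D) ->
  (forall v w, v != w -> 3 * k + 2 * (c * D) <= #|overlap G v w|) ->
  exactly_reconstructable 2 G.
Proof.
move=> tf codeg degD ovl H GH.
have fixN v : exists f g : T -> T,
    [/\ f v = v, forall w, adj G v w -> f w = w,
        {in gball H 2 v, forall y, g y \in gball G 2 v /\ f (g y) = y}
      & {in gball G 2 v &, forall x y, adj H (f x) (f y) = adj G x y}].
  have [f [g [[fv gv] fB gB fadj]]] := nbhd_isoP (GH v).
  exists f, g; split=> // w vw.
  have [f2 [g2 [[f2v g2v] f2B g2B f2adj]]] := nbhd_isoP (GH (f w)).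
  apply/eqP/negPn/negP => fw.
  pose phi x := g2 (f x).
  pose K := w |: (nbrs G w :|: overlap G v w).
  have wG : w \in gball G 2 v by exact: gball2_nbr.
  have bG b : b \in nbrs G w -> b \in gball G 2 v.
    by rewrite inE; apply: gball2_nbr2.
  have bH b : b \in nbrs G w -> adj H (f w) (f b).
    by move=> bw; rewrite (fadj _ _ wG (bG _ bw)); move: bw; rewrite in_nbrs.
  have KG x : x \in K -> x \in gball G 2 v.
    by rewrite 2!inE => /orP[/eqP->//|/finset.setUP[/bG//|]]; rewrite inE => /andP[].
  have KH x : x \in K -> f x \in gball H 2 (f w).
    rewrite 2!inE => /orP[/eqP->|/finset.setUP[bw|]]; first exact: gball_center.
      by apply: gball2_nbr; apply: bH.
    rewrite inE => /andP[xG /existsP[b /andP[wb bx]]].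
    have bw : b \in nbrs G w by rewrite inE.
    by apply: (gball2_nbr2 (bH _ bw)); rewrite fadj // bG.
  have phi_adj : {in K &, forall x y, adj G (phi x) (phi y) = adj G x y}.
    move=> x y xK yK.
    have [g2x f2x] := g2B _ (KH _ xK); have [g2y f2y] := g2B _ (KH _ yK).
    by rewrite -(fadj _ _ (KG _ xK) (KG _ yK)) -(f2adj _ _ g2x g2y) f2x f2y.
  have phi_inj : {in K &, injective phi}.
    move=> x y xK yK e.
    have [_ f2x] := g2B _ (KH _ xK); have [_ f2y] := g2B _ (KH _ yK).
    have [_ gx] := fB _ (KG _ xK); have [_ gy] := fB _ (KG _ yK).
    by rewrite -gx -gy -f2x -f2y -/(phi x) e.
  have phiw : phi w = f w by rewrite /phi g2v.
  have wK : w \in K by rewrite !inE eqxx.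
  have NK b : b \in nbrs G w -> b \in K by move=> bw; rewrite 2!inE finset.inE bw orbT.
  have OK x : x \in overlap G v w -> x \in K.
    by move=> xo; rewrite 2!inE finset.inE xo !orbT.
  pose M := [set x in overlap G v w | phi x != x].
  have MO x : x \in M -> x \in overlap G v w by rewrite inE => /andP[].
  have cM : #|M| < 3 * k.
    apply: (twin_free_moved (phi := phi) tf).
    - by move=> x y /MO/OK xK /MO/OK yK; apply: phi_inj.
    - by move=> x; rewrite inE => /andP[].
    - by move=> x y /MO/OK xK /MO/OK yK; apply: phi_adj.
  (* the fixed vertices reached through a fixed, respectively a moved, neighbour
     of w *)
  pose A1 := \bigcup_(b in conbrs G w (f w)) nbrs G b.
  pose A2 := \bigcup_(b in [set b in nbrs G w | phi b != b]) conbrs G b (phi b).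
  have cA1 : #|A1| <= c * D.
    apply: leq_trans (card_bigcup_leq _) (_ : _ * D <= _).
      by move=> b _; apply: degD.
    by rewrite leq_mul2r codeg ?orbT // eq_sym.
  have cA2 : #|A2| <= c * D.
    apply: leq_trans (card_bigcup_leq (m := c) _) _.
      by move=> b; rewrite inE => /andP[_ bb]; apply: codeg; rewrite eq_sym.
    rewrite mulnC leq_mul2l; apply/orP; right; apply: leq_trans (degD w).
    by apply: subset_leq_card; apply/fintype.subsetP => b; rewrite inE => /andP[].
  have sub : overlap G v w \subset M :|: (A1 :|: A2).
    apply/fintype.subsetP => x xo; rewrite finset.inE [x \in M]finset.inE xo.
    case px: (phi x == x) => //=.
    have /existsP[b /andP[wb bx]] : [exists b, adj G w b && adj G b x].
      by move: xo; rewrite inE => /andP[].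
    have bN : b \in nbrs G w by rewrite inE.
    have pb : adj G (f w) (phi b) by rewrite -phiw phi_adj // NK.
    have pbx : adj G (phi b) x.
      by have := phi_adj _ _ (NK _ bN) (OK _ xo); rewrite (eqP px) => ->.
    apply/finset.setUP; case: (eqVneq (phi b) b) => [e|ne]; [left|right].
      apply/finset.bigcupP; exists b; last by rewrite inE.
      by move: pb; rewrite e !inE wb => ->.
    apply/finset.bigcupP; exists b; first by rewrite !inE wb.
    by rewrite !inE bx pbx.
  have := subset_leq_card sub.
  have := leq_of_leqif (leq_card_setU M (A1 :|: A2)).
  have := leq_of_leqif (leq_card_setU A1 A2).
  have := ovl v w (adj_neq vw).
  lia.
apply: adj_ext => v y; have [f [g [fv fN gB fadj]]] := fixN v.
have vG : v \in gball G 2 v by exact: gball_center.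
apply/idP/idP => [vy|vy].
  have [gyG fgy] := gB _ (gball2_nbr vy).
  have Gvg : adj G v (g y) by rewrite -fadj // fv fgy.
  by rewrite -fgy fN.
by rewrite -{1}fv -(fN _ vy) fadj //; exact: gball2_nbr.
Qed.
End Deterministic.

(** * Degrees of neighbours as a vertex invariant *)

Section DegreeCounts.
Context {T : finType}.
Implicit Types (G : sgraph T) (x y : T).

Definition deg_class G k : {set T} := [set y | #|nbrs G y| == k].

(** Unlike the degree, this function of [k] tells the vertices of a dense random
    graph apart. *)
Definition nbr_degs G x k : nat := #|[set y in nbrs G x | #|nbrs G y| == k]|.

Lemma card_fibers (A : {set T}) (f : T -> nat) n :
  (forall y, y \in A -> f y <= n) ->
  \sum_(k < n.+1) #|[set y in A | f y == k]| = #|A|.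
Proof.
move=> fn; rewrite -sum1_card.
rewrite (partition_big (fun y => inord (f y) : 'I_n.+1) predT) //=.
apply: eq_bigr => k _; rewrite -sum1_card; apply: eq_bigl => y; rewrite inE.
case yA: (y \in A) => //=; apply/eqP/eqP => [e|<-].
  by rewrite e inord_val.
by rewrite inordK // ltnS fn.
Qed.

Lemma sum_nbr_degs G x : \sum_(k < #|T|.+1) nbr_degs G x k = #|nbrs G x|.
Proof. by apply: card_fibers => y _; apply: max_card. Qed.

(** This version of the degree of [y] does not depend on the edges at [x] and
    [x'], so it remains fixed while those edges are resampled. *)
Definition deg_off G x x' y : nat := #|nbrs G y :\: [set x; x']|.
Definition off_class G x x' k : {set T} :=
  [set y in ~: [set x; x'] | deg_off G x x' y == k].

Lemma in_off_class G x x' k y : (y \in off_class G x x' k) =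
  (y \in ~: [set x; x']) && (deg_off G x x' y == k).
Proof. by rewrite [LHS]finset.in_set. Qed.

Lemma deg_offE G x x' y : x != x' ->
  #|nbrs G y| = deg_off G x x' y + adj G x y + adj G x' y.
Proof.
move=> xx'; rewrite /deg_off -(cardsID [set x; x'] (nbrs G y)) addnC -addnA; congr addn.
rewrite (cardsD1 x) (cardsD1 x') !inE !eqxx !orbT !andbT.
rewrite [x' == x]eq_sym (negPf xx') /= !(adj_sym G y).
rewrite (_ : #|_| = 0) ?addn0 //; apply: eq_card0 => z; rewrite !inE.
by case: (z == x); case: (z == x') => //=; rewrite ?andbF.
Qed.

(** Among the neighbours of [x] with [deg_off] equal to [k], those not adjacent
    to [x'] have degree [k + 1] and the others [k + 2].  The neighbours of [x]
    and of [x'] of degree [k + 1] consist of private ones with [deg_off] equal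
    to [k], of common ones, and possibly of [x'] and [x] themselves, which
    contribute equally since their degrees agree.  Subtracting what is common gives equally many private
    neighbours. *)
Lemma card_nbrs_off_class_eq G x x' k : x != x' ->
  (forall j, nbr_degs G x j = nbr_degs G x' j) ->
  #|nbrs G x :&: off_class G x x' k| = #|nbrs G x' :&: off_class G x x' k|.
Proof.
move=> xx' eqh.
have degE : #|nbrs G x| = #|nbrs G x'|.
  by rewrite -!sum_nbr_degs; apply: eq_bigr => j _.
(* private neighbours of a, counted by deg_off, and common neighbours, counted by
   degree *)
pose side a b := [set y in ~: [set x; x'] |
  [&& adj G a y, ~~ adj G b y & deg_off G x x' y == k]].
pose both j := [set y in ~: [set x; x'] |
  [&& adj G x y, adj G x' y & deg_off G x x' y + 2 == j]].
have split1 a b : (a == x) && (b == x') || (a == x') && (b == x) ->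
    nbr_degs G a k.+1 = (adj G a b && (#|nbrs G b| == k.+1)) + (#|side a b| + #|both k.+1|).
  move=> ab; rewrite /nbr_degs (cardsD1 b) !inE; congr addn.
  have -> : [set y in nbrs G a | #|nbrs G y| == k.+1] :\ b = side a b :|: both k.+1.
    apply/setP => y; rewrite !inE.
    case/orP: ab => /andP[/eqP-> /eqP->].
      rewrite (deg_offE _ y xx') negb_or.
      case: (eqVneq y x) => [->|yx] /=; first by rewrite !adj_irr andbF.
      case: (eqVneq y x') => [->|yx'] //=.
      by case: (adj G x y); case: (adj G x' y); rewrite ?andbF ?orbF //=; lia.
    rewrite (deg_offE _ y xx') negb_or.
    case: (eqVneq y x') => [->|yx] /=; first by rewrite !adj_irr !andbF.
    case: (eqVneq y x) => [->|yx'] //=.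
    by case: (adj G x y); case: (adj G x' y); rewrite ?andbF ?orbF //=; lia.
  rewrite cardsU (_ : _ :&: _ = finset.set0) ?cards0 ?subn0 //.
  apply/setP => y; rewrite !inE.
  case/orP: ab => /andP[/eqP-> /eqP->];
  by case: (adj G x y); case: (adj G x' y); rewrite ?andbF.
have sideE : #|side x x'| = #|side x' x|.
  have := eqh k.+1; rewrite (split1 x x') ?eqxx // (split1 x' x) ?eqxx ?orbT //.
  by rewrite degE [adj G x' x]adj_sym => /addnI /addIn.
have split2 a b : (a == x) && (b == x') || (a == x') && (b == x) ->
    #|nbrs G a :&: off_class G x x' k| = #|side a b| + #|both k.+2|.
  move=> ab.
  have -> : nbrs G a :&: off_class G x x' k = side a b :|: both k.+2.
    apply/setP => y; rewrite !inE.
    case/orP: ab => /andP[/eqP-> /eqP->];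
    case: (adj G x y); case: (adj G x' y); rewrite ?andbF ?orbF //=;
    by case: (_ || _) => //=; lia.
  rewrite cardsU (_ : _ :&: _ = finset.set0) ?cards0 ?subn0 //.
  apply/setP => y; rewrite !inE.
  case/orP: ab => /andP[/eqP-> /eqP->];
  by case: (adj G x y); case: (adj G x' y); rewrite ?andbF.
by rewrite (split2 x x') ?eqxx // (split2 x' x) ?eqxx ?orbT // sideE.
Qed.

Lemma off_class_le G x x' k M : x != x' ->
  (forall j, #|deg_class G j| < M) -> #|off_class G x x' k| <= 3 * M.
Proof.
move=> xx' hM.
have sub : off_class G x x' k \subset
    deg_class G k :|: (deg_class G k.+1 :|: deg_class G k.+2).
  apply/fintype.subsetP => y; rewrite !inE (deg_offE _ y xx') => /andP[_ /eqP ->].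
  by case: (adj G x y); case: (adj G x' y); rewrite /= ?addn0 ?addn1 eqxx ?orbT.
apply: leq_trans (subset_leq_card sub) _.
have h1 := leq_of_leqif (leq_card_setU (deg_class G k) (deg_class G k.+1 :|: deg_class G k.+2)).
have h2 := leq_of_leqif (leq_card_setU (deg_class G k.+1) (deg_class G k.+2)).
by have := hM k; have := hM k.+1; have := hM k.+2; lia.
Qed.

End DegreeCounts.

(** The first clause makes every ball of radius 2 the whole graph, the second
    every automorphism trivial. *)
Definition separated (T : finType) (G : sgraph T) : Prop :=
  (forall x y, x != y -> exists z, adj G x z && adj G z y) /\
  (forall x y, (forall k, nbr_degs G x k = nbr_degs G y k) -> x = y).

Lemma nbrs_iso (T U : finType) (G : sgraph T) (H : sgraph U) (f : T -> U) :
  bijective f -> (forall x y, adj H (f x) (f y) = adj G x y) ->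
  forall x, nbrs H (f x) = f @: nbrs G x.
Proof.
case=> g fK gK fadj x; apply/setP => y; rewrite in_nbrs -(gK y) fadj.
by rewrite (mem_imset _ _ (can_inj fK)) in_nbrs.
Qed.

Lemma nbr_degs_iso (T U : finType) (G : sgraph T) (H : sgraph U) (f : T -> U) :
  bijective f -> (forall x y, adj H (f x) (f y) = adj G x y) ->
  forall x k, nbr_degs H (f x) k = nbr_degs G x k.
Proof.
move=> fb fadj x k; have finj := bij_inj fb.
rewrite /nbr_degs -(card_imset _ finj); apply: eq_card => y.
have [g fK gK] := fb; rewrite -(gK y) (mem_imset _ _ finj) !finset.in_set.
by rewrite fadj (nbrs_iso fb fadj) (card_imset _ finj).
Qed.

Lemma separated_gball (T : finType) (G : sgraph T) v x :
  separated G -> x \in gball G 2 v.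
Proof.
case=> cn _; case: (eqVneq v x) => [<-|vx]; first exact: gball_center.
by have [z /andP[vz zx]] := cn _ _ vx; apply: gball2_nbr2 vz zx.
Qed.

Lemma separated_iso (T : finType) (G : sgraph T) v (B : rooted_graph) :
  separated G -> rooted_iso (nbhd 2 G v) B ->
  exists f : T -> rvertex B, [/\ bijective f,
    forall x y, adj (Defs.rgraph B) (f x) (f y) = adj G x y & f v = rroot B].
Proof.
move=> sG [h [[h' hK h'K] hadj hroot]].
pose lft x : rvertex (nbhd 2 G v) := exist _ x (separated_gball v x sG).
exists (fun x => h (lft x)); split.
- exists (fun y => sval (h' y)) => x; first by rewrite hK.
  rewrite -[RHS]h'K; congr h; exact: val_inj.
- by move=> x y; rewrite hadj adj_induced.
- by rewrite -hroot; congr h; apply: val_inj.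
Qed.

(** An isomorphism of [G] with [H] that fixes [v] shows that [v] has the same
    invariant in both graphs.  Since this holds for every [v], any isomorphism
    of [G] with [H] preserves the invariant of [G], so it is the identity. *)
Lemma separated_reconstructable (T : finType) (G : sgraph T) :
  separated G -> exactly_reconstructable 2 G.
Proof.
move=> sG H GH; have [_ inj] := sG.
have glob v : exists F : T -> T, [/\ bijective F,
    forall x y, adj H (F x) (F y) = adj G x y & F v = v].
  have [f [fb fadj fv]] := separated_iso sG (GH v).
  exists (fun x => val (f x)); split.
  - apply: injF_bij => x y /val_inj; exact: (bij_inj fb).
  - by move=> x y; rewrite -fadj adj_induced.
  - by rewrite fv.
have same v k : nbr_degs H v k = nbr_degs G v k.
  by have [F [Fb Fadj Fv]] := glob v; rewrite -{1}Fv (nbr_degs_iso Fb Fadj).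
apply: adj_ext => x y; have [F [Fb Fadj Fv]] := glob x.
have FE z : F z = z.
  by apply: inj => k; rewrite -same (nbr_degs_iso Fb Fadj).
by rewrite -{1}(FE x) -{1}(FE y) Fadj.
Qed.

(** * Loop programs *)

Section LoopPrograms.

(** Loops run exactly as many times as register 0 says, which the program keeps
    equal to [n].  Termination and a polynomial time bound can then be read off
    the syntax, and correctness is a statement about the function [run]. *)
Inductive loop :=
  | LSkip
  | LAssign of nat & expr
  | LPut of nat & expr & expr
  | LSeq of loop & loop
  | LIf of expr & loop & loop
  | LFor of nat & loop.

Fixpoint compile (c : loop) : cmd :=
  match c with
  | LSkip => Skip
  | LAssign x e => Assign x e
  | LPut a e1 e2 => Put a e1 e2
  | LSeq c1 c2 => Seq (compile c1) (compile c2)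
  | LIf e c1 c2 => If e (compile c1) (compile c2)
  | LFor x c => Seq (Assign x (Const 0))
      (While (Minus (Reg 0) (Reg x))
         (Seq (compile c) (Assign x (Plus (Reg x) (Const 1)))))
  end.

Fixpoint run (n : nat) (c : loop) (s : state) : state :=
  match c with
  | LSkip => s
  | LAssign x e => set_reg s x (Defs.eval s e)
  | LPut a e1 e2 => set_cell s a (Defs.eval s e1) (Defs.eval s e2)
  | LSeq c1 c2 => run n c2 (run n c1 s)
  | LIf e c1 c2 => if Defs.eval s e == 0 then run n c2 s else run n c1 s
  | LFor x c => iter n (fun s => set_reg (run n c s) x (regs (run n c s) x + 1))
      (set_reg s x 0)
  end.

Fixpoint assigns (c : loop) (y : nat) : bool :=
  match c with
  | LSkip | LPut _ _ _ => false
  | LAssign x _ => y == x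
  | LSeq c1 c2 | LIf _ c1 c2 => assigns c1 y || assigns c2 y
  | LFor x c => (y == x) || assigns c y
  end.

Fixpoint puts (c : loop) (b : nat) : bool :=
  match c with
  | LSkip | LAssign _ _ => false
  | LPut a _ _ => b == a
  | LSeq c1 c2 | LIf _ c1 c2 => puts c1 b || puts c2 b
  | LFor _ c => puts c b
  end.

(** These conditions make the compiled while loops perform exactly the
    iterations counted by [run]. *)
Fixpoint proper (c : loop) : bool :=
  match c with
  | LSkip | LPut _ _ _ => true
  | LAssign x _ => x != 0
  | LSeq c1 c2 | LIf _ c1 c2 => proper c1 && proper c2
  | LFor x c => [&& x != 0, ~~ assigns c x & proper c]
  end.

Lemma run_regs n c s y : ~~ assigns c y -> regs (run n c s) y = regs s y.
Proof.
elim: c s => //= [x e|c1 IH1 c2 IH2|e c1 IH1 c2 IH2|x c IH] s.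
- by move=> /negPf ->.
- by rewrite negb_or => /andP[h1 h2]; rewrite IH2 // IH1.
- by rewrite negb_or => /andP[h1 h2]; case: ifP => _; [rewrite IH2|rewrite IH1].
- rewrite negb_or => /andP[/negPf yx h].
  set F := fun s0 : state => set_reg _ _ _.
  suff H m : regs (iter m F (set_reg s x 0)) y = regs s y by [].
  by elim: m => [|m IHm]; rewrite /= yx // IH.
Qed.

Lemma run_arrays n c s b : ~~ puts c b -> arrays (run n c s) b = arrays s b.
Proof.
elim: c s => //= [a e1 e2|c1 IH1 c2 IH2|e c1 IH1 c2 IH2|x c IH] s.
- by move=> /negPf ->.
- by rewrite negb_or => /andP[h1 h2]; rewrite IH2 // IH1.
- by rewrite negb_or => /andP[h1 h2]; case: ifP => _; [rewrite IH2|rewrite IH1].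
- move=> h; set F := fun s0 : state => set_reg _ _ _.
  suff H m : arrays (iter m F (set_reg s x 0)) b = arrays s b by [].
  by elim: m => [|m IHm] //=; rewrite IH.
Qed.

Lemma proper_reg0 c : proper c -> ~~ assigns c 0.
Proof.
elim: c => //= [x _|c1 IH1 c2 IH2|_ c1 IH1 c2 IH2|x c IH].
- by rewrite eq_sym.
- by move=> /andP[/IH1 h1 /IH2 h2]; rewrite negb_or h1.
- by move=> /andP[/IH1 h1 /IH2 h2]; rewrite negb_or h1.
- by move=> /and3P[x0 _ /IH h]; rewrite negb_or eq_sym x0.
Qed.

(** Invariant rule for loops.  The step may assume that the registers and arrays
    that the body does not write are as they were before the loop, so that an
    invariant speaks only of what the loop changes. *)
Lemma run_for_ind n x c (I : nat -> state -> Prop) s :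
  proper (LFor x c) -> I 0 (set_reg s x 0) ->
  (forall i s', i < n -> regs s' x = i ->
     (forall y, y != x -> ~~ assigns c y -> regs s' y = regs s y) ->
     (forall b, ~~ puts c b -> arrays s' b = arrays s b) ->
     I i s' -> I i.+1 (set_reg (run n c s') x i.+1)) ->
  I n (run n (LFor x c) s).
Proof.
move=> /and3P[x0 xc pc] I0 Istep /=.
set s0 := set_reg s x 0 in I0 *.
suff h m : m <= n -> [/\ I m (iter m (fun s => set_reg (run n c s) x (regs (run n c s) x + 1)) s0),
    regs (iter m (fun s => set_reg (run n c s) x (regs (run n c s) x + 1)) s0) x = m,
    forall y, y != x -> ~~ assigns c y ->
      regs (iter m (fun s => set_reg (run n c s) x (regs (run n c s) x + 1)) s0) y = regs s y
    & forall b, ~~ puts c b ->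
      arrays (iter m (fun s => set_reg (run n c s) x (regs (run n c s) x + 1)) s0) b = arrays s b].
  by have [] := h n (leqnn n).
elim: m => [_|m IH mn] /=.
  split=> //; first by rewrite eqxx.
  by move=> y /negPf yx _; rewrite /= yx.
have [Im xm rm am] := IH (ltnW mn).
set s' := iter m _ s0 in Im xm rm am *.
rewrite run_regs // xm addn1; split.
- exact: Istep.
- by rewrite eqxx.
- by move=> y yx yc; rewrite (negPf yx) run_regs // rm.
- by move=> b bc; rewrite run_arrays // am.
Qed.

(** Exponents of commands run one after the other are added, which is coarse but
    avoids maxima: any polynomial bound will do.  The constant 9
    covers the test, the increment and the composition in each iteration, and
    the cost of starting and leaving the loop. *)
Fixpoint time_const (c : loop) : nat :=
  match c with
  | LSkip => 1
  | LAssign _ e => (cost e).+1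
  | LPut _ e1 e2 => (cost e1 + cost e2).+1
  | LSeq c1 c2 => (time_const c1 + time_const c2).+1
  | LIf e c1 c2 => (cost e + (time_const c1 + time_const c2)).+1
  | LFor _ c => time_const c + 9
  end.

Fixpoint time_exp (c : loop) : nat :=
  match c with
  | LSkip | LAssign _ _ | LPut _ _ _ => 0
  | LSeq c1 c2 | LIf _ c1 c2 => time_exp c1 + time_exp c2
  | LFor _ c => (time_exp c).+1
  end.

Lemma exec_compile n c s : proper c -> regs s 0 = n ->
  exists2 t, exec (compile c) s t (run n c s)
    & t <= time_const c * n.+1 ^ time_exp c.
Proof.
have pw d d' k : d <= d' -> k * n.+1 ^ d <= k * n.+1 ^ d'.
  by move=> dd; rewrite leq_mul2l leq_pexp2l ?orbT.
elim: c s => /= [|x e|a e1 e2|c1 IH1 c2 IH2|e c1 IH1 c2 IH2|x c IH] s.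
- by exists 1 => //; constructor.
- by exists (cost e).+1; [constructor|rewrite expn0 muln1].
- by exists (cost e1 + cost e2).+1; [constructor|rewrite expn0 muln1].
- move=> /andP[p1 p2] s0; have [t1 h1 b1] := IH1 s p1 s0.
  have [t2 h2 b2] : exists2 t, exec (compile c2) (run n c1 s) t (run n c2 (run n c1 s))
      & t <= time_const c2 * n.+1 ^ time_exp c2.
    by apply: IH2 => //; rewrite run_regs // proper_reg0.
  exists (t1 + t2).+1; first exact: exec_seq h1 h2.
  have := pw _ _ (time_const c1) (leq_addr (time_exp c2) (time_exp c1)).
  have := pw _ _ (time_const c2) (leq_addl (time_exp c1) (time_exp c2)).
  have : 0 < n.+1 ^ (time_exp c1 + time_exp c2) by rewrite expn_gt0.
  by rewrite mulSn mulnDl; lia.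
- move=> /andP[p1 p2] s0.
  have E := pw _ _ (time_const c1) (leq_addr (time_exp c2) (time_exp c1)).
  have E' := pw _ _ (time_const c2) (leq_addl (time_exp c1) (time_exp c2)).
  have pos : 0 < n.+1 ^ (time_exp c1 + time_exp c2) by rewrite expn_gt0.
  have ce : cost e <= cost e * n.+1 ^ (time_exp c1 + time_exp c2) by rewrite leq_pmulr.
  case: eqP => es.
    have [t h b] := IH2 s p2 s0; exists (cost e + t).+1; first exact: exec_if_false.
    by rewrite mulSn !mulnDl; lia.
  have [t h b] := IH1 s p1 s0; exists (cost e + t).+1; first exact: exec_if_true.
  by rewrite mulSn !mulnDl; lia.
- move=> /and3P[x0 xc pc] s0.
  pose step s' := set_reg (run n c s') x (regs (run n c s') x + 1).
  pose W := While (Minus (Reg 0) (Reg x))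
    (Seq (compile c) (Assign x (Plus (Reg x) (Const 1)))).
  have loop_from m s' : m <= n -> regs s' 0 = n -> regs s' x = n - m ->
      exists2 t, exec W s' t (iter m step s') &
        t <= m * (time_const c * n.+1 ^ time_exp c + 9) + 4.
    elim: m s' => [|m IHm] s' mn r0 rx.
      exists 4 => //; apply: (exec_while_false (e := Minus (Reg 0) (Reg x))).
      by rewrite /= r0 rx subn0 subnn.
    have [t1 h1 b1] := IH s' pc r0.
    have stepE : exec (Seq (compile c) (Assign x (Plus (Reg x) (Const 1)))) s' (t1 + 4).+1 (step s').
      exact: exec_seq h1 (exec_assign _ x (Plus (Reg x) (Const 1))).
    have [t2 h2 b2] : exists2 t, exec W (step s') t (iter m step (step s')) &
        t <= m * (time_const c * n.+1 ^ time_exp c + 9) + 4.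
      apply: IHm; first exact: ltnW.
        by rewrite /step /= eq_sym (negPf x0) run_regs // proper_reg0.
      by rewrite /step /= eqxx run_regs // rx; lia.
    exists (3 + (t1 + 4).+1 + t2).+1.
      rewrite iterSr; apply: (exec_while_true (e := Minus (Reg 0) (Reg x))) stepE h2.
      by rewrite /= r0 rx; lia.
    by rewrite mulSn; lia.
  have [||t ht bt] := loop_from n (set_reg s x 0) (leqnn n).
  - by rewrite /= eq_sym (negPf x0).
  - by rewrite /= eqxx subnn.
  exists (2 + t).+1; first exact: exec_seq (exec_assign s x (Const 0)) ht.
  rewrite expnS; have : 0 < n.+1 ^ time_exp c by rewrite expn_gt0.
  by move: bt; move: (n.+1 ^ time_exp c) (time_const c) => E K; clear; nia.
Qed.

Lemma run_assign n x e s : run n (LAssign x e) s = set_reg s x (Defs.eval s e).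
Proof. by []. Qed.

Lemma run_put n a e1 e2 s :
  run n (LPut a e1 e2) s = set_cell s a (Defs.eval s e1) (Defs.eval s e2).
Proof. by []. Qed.

Lemma run_seq n c1 c2 s : run n (LSeq c1 c2) s = run n c2 (run n c1 s).
Proof. by []. Qed.

Lemma run_if n e c1 c2 s : run n (LIf e c1 c2) s =
  if Defs.eval s e == 0 then run n c2 s else run n c1 s.
Proof. by []. Qed.

End LoopPrograms.

Arguments run : simpl never.

(** * The reconstruction program *)

Section Program.

(** Register 0 holds [n], registers 1 and 2 the labels [i] and [j] of the output
    cell being computed, registers 3, 4 and 5 inner loop counters.  Array 2 holds
    the multiples of [n], since the machine cannot multiply; array 3 the position
    of the adjacency matrix of each neighbourhood in the input; array 4 the degree
    of each vertex of each neighbourhood.  The program is written for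
    neighbourhoods that all have [n] vertices; its running time is bounded
    in terms of [n] alone. *)
Definition entry (v : nat) (a b : expr) : expr :=
  Get 0 (Plus (Get 3 (Reg v)) (Plus (Get 2 a) b)).

Definition root_of (v : nat) : expr := Get 0 (Minus (Get 3 (Reg v)) (Const 1)).

Definition absdiff (e1 e2 : expr) : expr := Plus (Minus e1 e2) (Minus e2 e1).

Definition mul_phase : loop :=
  LFor 1 (LPut 2 (Plus (Reg 1) (Const 1)) (Plus (Get 2 (Reg 1)) (Reg 0))).

Definition off_phase : loop :=
  LSeq (LPut 3 (Const 0) (Const 3))
    (LFor 1 (LPut 3 (Plus (Reg 1) (Const 1))
       (Plus (Get 3 (Reg 1)) (Plus (Get 2 (Reg 0)) (Const 2))))).

Definition deg_sum : loop := LFor 3 (LAssign 6 (Plus (Reg 6) (entry 1 (Reg 2) (Reg 3)))).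

Definition deg_cell : loop :=
  LSeq (LAssign 6 (Const 0)) (LSeq deg_sum (LPut 4 (Plus (Get 2 (Reg 1)) (Reg 2)) (Reg 6))).

Definition deg_row : loop := LFor 2 deg_cell.

Definition deg_phase : loop := LFor 1 deg_row.

Definition count_step (v : nat) (x : expr) (dst : nat) : loop :=
  LIf (absdiff (Get 4 (Plus (Get 2 (Reg v)) (Reg 5))) (Reg 4))
    LSkip (LAssign dst (Plus (Reg dst) (entry v x (Reg 5)))).

Definition count_loop (v : nat) (x : expr) (dst : nat) : loop :=
  LSeq (LAssign dst (Const 0)) (LFor 5 (count_step v x dst)).

(** Register 8 adds up the differences between the invariant of vertex [Reg 3]
    of the copy at [i] and that of the root of the copy at [j], so it stays 0
    exactly when they agree. *)
Definition diff_step : loop :=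
  LSeq (count_loop 1 (Reg 3) 6) (LSeq (count_loop 2 (root_of 2) 7)
    (LAssign 8 (Plus (Reg 8) (absdiff (Reg 6) (Reg 7))))).

Definition diff_loop : loop := LSeq (LAssign 8 (Const 0)) (LFor 4 diff_step).

Definition scan_step : loop :=
  LSeq diff_loop (LIf (Reg 8) LSkip (LAssign 9 (entry 1 (root_of 1) (Reg 3)))).

Definition scan_loop : loop := LSeq (LAssign 9 (Const 0)) (LFor 3 scan_step).

Definition match_cell : loop :=
  LSeq scan_loop (LPut 1 (Plus (Get 2 (Reg 1)) (Reg 2)) (Reg 9)).

Definition match_row : loop := LFor 2 match_cell.

Definition match_phase : loop := LFor 1 match_row.

Definition all_phases : loop :=
  LSeq mul_phase (LSeq off_phase (LSeq deg_phase match_phase)).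

Definition program : cmd :=
  Seq (Assign 0 (Get 0 (Const 0))) (compile all_phases).

Context (A : nat -> nat) (n : nat).

(** The encoding starts with [n], and each neighbourhood is preceded by its size
    and its root; hence the offset 3 and the stride [n * n + 2]. *)
Definition block v := 3 + v * (n * n + 2).
Definition mat v a b := A (block v + (a * n + b)).
Definition root v := A (block v - 1).
Definition degr v a := \sum_(b < n) mat v a b.
Definition cnt v x k := \sum_(z < n) (if degr v z == k then mat v x z else 0).
Definition diff i j y := \sum_(k < n) (cnt i y k - cnt j (root j) k + (cnt j (root j) k - cnt i y k)).
Fixpoint scan i j m :=
  if m is m'.+1 then if diff i j m' == 0 then mat i (root i) m' else scan i j m'
  else 0.

Context (root_lt : forall v, v < n -> root v < n).

(** What the first two phases establish and the later ones leave alone. *)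
Record tables (s : state) : Prop := Tables {
  tab0 : arrays s 0 = A;
  tabn : regs s 0 = n;
  tab2 : forall a, a <= n -> arrays s 2 a = a * n;
  tab3 : forall v, v < n -> arrays s 3 v = block v }.

Lemma tables_frame c s : tables s -> proper c ->
  ~~ puts c 0 -> ~~ puts c 2 -> ~~ puts c 3 -> tables (run n c s).
Proof.
case=> t0 tn t2 t3 pc p0 p2 p3; split; rewrite ?run_arrays // run_regs //.
exact: proper_reg0.
Qed.

Lemma tables_same s s' : tables s -> regs s' 0 = regs s 0 ->
  arrays s' 0 = arrays s 0 -> arrays s' 2 = arrays s 2 -> arrays s' 3 = arrays s 3 ->
  tables s'.
Proof. by case=> t0 tn t2 t3 er e0 e2 e3; split; rewrite ?er ?e0 ?e2 ?e3. Qed.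

Lemma eval_entry s v a b : tables s -> regs s v < n -> Defs.eval s a <= n ->
  Defs.eval s (entry v a b) = mat (regs s v) (Defs.eval s a) (Defs.eval s b).
Proof. by case=> t0 tn t2 t3 vn an /=; rewrite t0 t3 // t2. Qed.

Lemma eval_root s v : tables s -> regs s v < n ->
  Defs.eval s (root_of v) = root (regs s v).
Proof. by case=> t0 tn t2 t3 vn /=; rewrite t0 t3. Qed.

Lemma mul_phase_spec s : regs s 0 = n -> arrays s 2 0 = 0 ->
  forall a, a <= n -> arrays (run n mul_phase s) 2 a = a * n.
Proof.
move=> s0 s2.
apply: (@run_for_ind n 1 _ (fun i s' => forall a, a <= i -> arrays s' 2 a = a * n)) => //.
  by move=> a; rewrite leqn0 => /eqP ->.
move=> i s' i_n x1 fr fa inv a; rewrite run_put /= x1 addn1.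
rewrite leq_eqVlt; case: eqP => [-> _|_ /= ai].
  by rewrite inv // fr // s0 mulSn addnC.
exact: inv.
Qed.

Lemma off_phase_spec s : regs s 0 = n -> arrays s 2 n = n * n ->
  forall v, v < n -> arrays (run n off_phase s) 3 v = block v.
Proof.
move=> s0 s2 v vn.
suff h : forall v, v <= n -> arrays (run n off_phase s) 3 v = block v.
  exact/h/ltnW.
rewrite run_seq run_put /=.
apply: (@run_for_ind n 1 _ (fun i s' => forall a, a <= i -> arrays s' 3 a = block a)) => //.
  by move=> a; rewrite leqn0 => /eqP ->.
move=> i s' i_n x1 fr fa inv a; rewrite run_put /= x1 addn1.
rewrite leq_eqVlt; case: eqP => [-> _|_ /= ai].
  by rewrite inv // fa //= fr //= s0 s2 /block; ring.
exact: inv.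
Qed.

(** The loop invariant describes an initial segment of the flat array, so that
    overwriting a later cell cannot disturb what was proved of earlier ones. *)
Lemma deg_phase_spec s : tables s ->
  forall v a, v < n -> a < n -> arrays (run n deg_phase s) 4 (v * n + a) = degr v a.
Proof.
move=> ts.
pose D z := degr (z %/ n) (z %% n).
suff h : forall z, z < n * n -> arrays (run n deg_phase s) 4 z = D z.
  move=> v a vn an; have n0 : 0 < n by apply: leq_ltn_trans an.
  rewrite h; last by nia.
  by rewrite /D divnMDl // divn_small // addn0 modnMDl modn_small.
apply: (@run_for_ind n 1 _ (fun i s' => forall z, z < i * n -> arrays s' 4 z = D z)) => //.
move=> i s' i_n x1 fr fa inv z /=.
have ts' : tables s' by apply: tables_same ts _ _ _ _; rewrite ?fr ?fa.
rewrite mulSn addnC; move: z.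
apply: (@run_for_ind n 2 _ (fun a s'' => forall z, z < i * n + a -> arrays s'' 4 z = D z)) => //.
  by move=> z'; rewrite addn0; apply: inv.
move=> a s'' a_n x2 fr' fa' inv' z zlt /=.
have ts'' : tables s'' by apply: tables_same ts' _ _ _ _; rewrite ?fr' ?fa'.
have x1'' : regs s'' 1 = i by rewrite fr'.
have cs : regs (run n deg_sum (set_reg s'' 6 0)) 6 = degr i a.
  apply: (@run_for_ind n 3 _ (fun b t => regs t 6 = \sum_(b' < b) mat i a b')) => //.
    by rewrite big_ord0.
  move=> b t b_n x3 fr3 fa3 inv3.
  have tt : tables t by apply: tables_same ts'' _ _ _ _; rewrite ?fr3 ?fa3.
  have t1 : regs t 1 = i by rewrite fr3.
  have t2 : regs t 2 = a by rewrite fr3.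
  have := @eval_entry t 1 (Reg 2) (Reg 3) tt; rewrite /= t1 t2 x3 => E.
  by rewrite big_ord_recr /= inv3 E // ltnW.
have [_ _ m2 _] := ts''.
rewrite ?run_seq ?run_put ?run_assign /= cs !(@run_regs n deg_sum) //=.
rewrite !(@run_arrays n deg_sum) //= x1'' x2 m2 ?(ltnW i_n) //.
case: eqP => [->|ne]; last by apply: inv'; move: ne zlt; lia.
by rewrite /D divnMDl ?divn_small ?addn0 ?modnMDl ?modn_small //; apply: leq_ltn_trans a_n.
Qed.

Lemma count_loop_spec s v x dst i a k : tables s ->
  (forall v a, v < n -> a < n -> arrays s 4 (v * n + a) = degr v a) ->
  v \in [:: 1; 2] -> dst \in [:: 6; 7] ->
  regs s v = i -> i < n -> regs s 4 = k -> a < n ->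
  (forall t, tables t -> (forall y, y != 5 -> y != dst -> regs t y = regs s y) ->
     Defs.eval t x = a) ->
  regs (run n (count_loop v x dst) s) dst = cnt i a k.
Proof.
move=> ts deg4 v12 d67 vi i_n k4 an evx.
have [dst0 dst4 dst5 dstv [v5 v0 v4]] :
    [/\ dst != 0, dst != 4, dst != 5, dst != v & [/\ v != 5, v != 0 & v != 4]].
  by move: v12 d67; rewrite !inE => /orP[]/eqP-> /orP[]/eqP->.
rewrite /count_loop run_seq run_assign.
apply: (@run_for_ind n 5 _ (fun z t => regs t dst =
    \sum_(z' < z) (if degr i z' == k then mat i a z' else 0))).
- by rewrite /= dst0 [5 == dst]eq_sym (negPf dst5).
- by rewrite big_ord0 /= (negPf dst5) eqxx.
move=> z t z_n t5 fr fa inv.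
have fr1 y : y != 5 -> y != dst -> regs t y = regs s y.
  by move=> y5 yd; rewrite fr //= (negPf yd).
have tt : tables t.
  by apply: tables_same ts _ _ _ _; rewrite ?fa // fr1 // eq_sym.
have tv : regs t v = i by rewrite fr1 // eq_sym.
have t4 : regs t 4 = k by rewrite fr1 // eq_sym.
have [_ _ m2 _] := tt.
have dz : arrays t 4 (arrays t 2 (regs t v) + regs t 5) = degr i z.
  by rewrite fa //= tv t5 m2 ?(ltnW i_n) // deg4.
have ea := evx t tt fr1.
have ee : Defs.eval t (entry v x (Reg 5)) = mat i a z.
  by rewrite eval_entry // ?tv // ea ?(ltnW an) //= t5.
rewrite big_ord_recr -inv run_if [Defs.eval t _]/= dz t4.
rewrite (_ : (_ == 0) = (degr i z == k)); last by lia.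
case: ifP => _ /=; last by rewrite addn0 (negPf dst5).
by rewrite eqxx (negPf dst5) -ee.
Qed.

Definition deg_table (s : state) := forall v a, v < n -> a < n ->
  arrays s 4 (v * n + a) = degr v a.

Lemma diff_loop_spec s i j y : tables s -> deg_table s ->
  regs s 1 = i -> i < n -> regs s 2 = j -> j < n -> regs s 3 = y -> y < n ->
  regs (run n diff_loop s) 8 = diff i j y.
Proof.
move=> ts ds s1 i_n s2 j_n s3 y_n; rewrite /diff_loop run_seq run_assign.
apply: (@run_for_ind n 4 _ (fun k t => regs t 8 = \sum_(k' < k)
  (cnt i y k' - cnt j (root j) k' + (cnt j (root j) k' - cnt i y k')))) => //.
  by rewrite big_ord0.
move=> k t k_n t4 fr fa inv; rewrite big_ord_recr /= -inv.
have tt : tables t by apply: tables_same ts _ _ _ _; rewrite ?fr ?fa.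
have dt : deg_table t by move=> v a vn an; rewrite fa //= ds.
have [t1 t2 t3] : [/\ regs t 1 = i, regs t 2 = j & regs t 3 = y] by rewrite !fr.
pose u := run n (count_loop 1 (Reg 3) 6) t.
have tu : tables u by apply: tables_frame.
have du : deg_table u by move=> v a vn an; rewrite /u run_arrays //= dt.
have u6 : regs u 6 = cnt i y k.
  by apply: count_loop_spec => // t' _ h; rewrite /= h.
have u7 : regs (run n (count_loop 2 (root_of 2) 7) u) 7 = cnt j (root j) k.
  apply: count_loop_spec => //; rewrite ?(run_regs, root_lt) //.
  move=> t' tt' h; have t'2 : regs t' 2 = j by rewrite h // run_regs.
  by rewrite eval_root // t'2.
rewrite /diff_step !run_seq -/u run_assign /= u7.
by rewrite !(@run_regs n (count_loop 2 (root_of 2) 7)) // u6 run_regs.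
Qed.

Lemma scan_loop_spec s i j : tables s -> deg_table s ->
  regs s 1 = i -> i < n -> regs s 2 = j -> j < n ->
  regs (run n scan_loop s) 9 = scan i j n.
Proof.
move=> ts ds s1 i_n s2 j_n; rewrite /scan_loop run_seq run_assign.
apply: (@run_for_ind n 3 _ (fun y t => regs t 9 = scan i j y)) => //.
move=> y t y_n t3 fr fa inv /=; rewrite -inv.
have tt : tables t by apply: tables_same ts _ _ _ _; rewrite ?fr ?fa.
have dt : deg_table t by move=> v a vn an; rewrite fa //= ds.
have [t1 t2] : [/\ regs t 1 = i & regs t 2 = j] by rewrite !fr.
pose u := run n diff_loop t.
have tu : tables u by apply: tables_frame.
have u8 : regs u 8 = diff i j y by apply: diff_loop_spec.
have [u1 u3 u9] : [/\ regs u 1 = i, regs u 3 = y & regs u 9 = regs t 9].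
  by rewrite /u !run_regs.
have ee : Defs.eval u (entry 1 (root_of 1) (Reg 3)) = mat i (root i) y.
  by rewrite eval_entry ?eval_root ?u1 //= ?u3 // ltnW // root_lt.
rewrite /scan_step run_seq -/u run_if [Defs.eval u (Reg 8)]/= u8.
by case: ifP => _; [rewrite run_assign ee|rewrite /= u9].
Qed.

Lemma match_phase_spec s : tables s -> deg_table s ->
  forall i j, i < n -> j < n ->
  arrays (run n match_phase s) 1 (i * n + j) = scan i j n.
Proof.
move=> ts ds.
pose D z := scan (z %/ n) (z %% n) n.
suff h : forall z, z < n * n -> arrays (run n match_phase s) 1 z = D z.
  move=> v a vn an; have n0 : 0 < n by apply: leq_ltn_trans an.
  rewrite h; last by nia.
  by rewrite /D divnMDl // divn_small // addn0 modnMDl modn_small.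
apply: (@run_for_ind n 1 _ (fun i s' => forall z, z < i * n -> arrays s' 1 z = D z)) => //.
move=> i s' i_n x1 fr fa inv z /=.
have ts' : tables s' by apply: tables_same ts _ _ _ _; rewrite ?fr ?fa.
have ds' : deg_table s' by move=> v a vn an; rewrite fa //= ds.
rewrite mulSn addnC; move: z.
apply: (@run_for_ind n 2 _ (fun a s'' => forall z, z < i * n + a -> arrays s'' 1 z = D z)) => //.
  by move=> z'; rewrite addn0; apply: inv.
move=> a s'' a_n x2 fr' fa' inv' z zlt /=.
have ts'' : tables s'' by apply: tables_same ts' _ _ _ _; rewrite ?fr' ?fa'.
have ds'' : deg_table s'' by move=> v b vn bn; rewrite fa' //= ds'.
have x1'' : regs s'' 1 = i by rewrite fr'.
have cs := scan_loop_spec ts'' ds'' x1'' i_n x2 a_n.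
have [_ _ m2 _] := ts''.
rewrite cs !(@run_regs n scan_loop) //.
rewrite !(@run_arrays n scan_loop) // x1'' x2 m2 ?(ltnW i_n) //.
case: eqP => [->|ne]; last by apply: inv'; move: ne zlt; lia.
by rewrite /D divnMDl ?divn_small ?addn0 ?modnMDl ?modn_small //; apply: leq_ltn_trans a_n.
Qed.

Lemma all_phases_spec s : regs s 0 = n -> arrays s 0 = A -> arrays s 2 0 = 0 ->
  forall i j, i < n -> j < n ->
  arrays (run n all_phases s) 1 (i * n + j) = scan i j n.
Proof.
move=> s0 sA s2; rewrite /all_phases !run_seq.
set s1 := run n mul_phase s; set s' := run n off_phase s1.
have m2 : forall a, a <= n -> arrays s1 2 a = a * n by apply: mul_phase_spec.
have ts : tables s'.
  split.
  - by rewrite /s' /s1 !run_arrays.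
  - by rewrite /s' /s1 !run_regs.
  - by move=> a an; rewrite /s' run_arrays // m2.
  - by apply: off_phase_spec; rewrite ?m2 // /s1 run_regs.
apply: match_phase_spec; first exact: tables_frame.
exact: deg_phase_spec.
Qed.

End Program.

Lemma program_run (w : seq nat) (n : nat) : nth 0 w 0 = n ->
  exists2 t, exec program (init_state w) t
      (run n all_phases (set_reg (init_state w) 0 n)) &
    t <= 4 + time_const all_phases * n.+1 ^ time_exp all_phases.
Proof.
move=> w0.
have [|t ht bt] := @exec_compile n all_phases (set_reg (init_state w) 0 n) isT; first by [].
exists (3 + t).+1; last by lia.
apply: exec_seq ht.
have := exec_assign (init_state w) 0 (Get 0 (Const 0)).
by rewrite /= w0.
Qed.

(** * Correctness of the program *)

Lemma nth_flatten_const (s : seq (seq nat)) m i j :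
  (forall t, t \in s -> size t = m) -> i < size s -> j < m ->
  nth 0 (flatten s) (i * m + j) = nth 0 (nth [::] s i) j.
Proof.
elim: s i => [|t s IH] [|i] //= sz.
  by move=> _ jm; rewrite nth_cat mul0n add0n sz ?inE ?eqxx // jm.
rewrite ltnS => ilt jm; rewrite nth_cat sz ?inE ?eqxx // mulSn.
rewrite ltnNge -addnA leq_addr /= addKn IH // => t' t's.
by apply: sz; rewrite inE t's orbT.
Qed.

Lemma size_adj_matrix m (G : sgraph 'I_m) : size (adj_matrix_seq G) = m * m.
Proof. by rewrite size_allpairs size_enum_ord. Qed.

Lemma nth_adj_matrix m (G : sgraph 'I_m) (a b : 'I_m) :
  nth 0 (adj_matrix_seq G) (a * m + b) = adj G a b.
Proof.
rewrite /adj_matrix_seq nth_flatten_const ?size_map -?enumT ?size_enum_ord //.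
  rewrite (nth_map a) ?size_enum_ord // nth_ord_enum.
  by rewrite (nth_map b) -?enumT ?size_enum_ord // nth_ord_enum.
by move=> t /mapP[x _ ->]; rewrite size_map -?enumT size_enum_ord.
Qed.

Section Decoding.
Context (n : nat) (X : 'I_n -> numbered_graph).
Context (sizeX : forall v, nsize (X v) = n).

Lemma nth_encode (v : 'I_n) j : j < n * n + 2 ->
  nth 0 (encode X) (v * (n * n + 2) + j).+1 = nth 0 (encode_numbered (X v)) j.
Proof.
move=> jlt; rewrite /encode /= nth_flatten_const ?size_map -?enumT ?size_enum_ord //.
  by rewrite (nth_map v) ?size_enum_ord // nth_ord_enum.
by move=> t /mapP[x _ ->]; rewrite /= size_adj_matrix sizeX addn2.
Qed.

Lemma root_encode (v : 'I_n) : root (nth 0 (encode X)) n v = nroot (X v).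
Proof.
rewrite /root /block (_ : 3 + _ - 1 = (v * (n * n + 2) + 1).+1); last by lia.
by rewrite nth_encode // addn2.
Qed.

Lemma mat_encode (v : 'I_n) (a b : 'I_(nsize (X v))) :
  mat (nth 0 (encode X)) n v a b = adj (ngraph (X v)) a b.
Proof.
rewrite -nth_adj_matrix /mat /block.
have -> : a * nsize (X v) = a * n by congr (_ * _); apply: sizeX.
rewrite (_ : 3 + _ + _ = (v * (n * n + 2) + (2 + (a * n + b))).+1); last by lia.
rewrite nth_encode //.
have : a < n by have := ltn_ord a; rewrite [X in _ < X]sizeX.
have : b < n by have := ltn_ord b; rewrite [X in _ < X]sizeX.
by clear; move: (nat_of_ord a) (nat_of_ord b) => i j; nia.
Qed.

End Decoding.

Lemma sum_reindex_nat n (g : 'I_n -> nat) (F : nat -> nat) :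
  injective g -> (forall x, g x < n) -> \sum_(z < n) F z = \sum_(x : 'I_n) F (g x).
Proof.
move=> ginj gn; pose h x : 'I_n := Ordinal (gn x).
have hinj : injective h by move=> x y /(congr1 val) /= /ginj.
by rewrite (reindex_inj hinj).
Qed.

(** Each copy is related to [G] by a numbering [g].  Degrees and invariants are
    transported along it, so the vertex [y] of copy [i] for which the difference
    with the root of copy [j] vanishes is the one that [g] assigns to [j], and
    its adjacency to the root of copy [i] is that of [i] and [j] in [G]. *)
Lemma program_reconstructs n (G : sgraph 'I_n) : separated G -> reconstructs 2 program G.
Proof.
move=> sG X pX; have [_ inj] := sG.
have [t ht _] := @program_run (encode X) n (erefl _).
exists t; eexists; split; first exact: ht.
set A := nth 0 (encode X).
have iso0 v := separated_iso sG (pX v).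
have sizeX v : nsize (X v) = n.
  by have [f [fb _ _]] := iso0 v; have := bij_eq_card fb; rewrite !card_ord.
have iso (v : 'I_n) : exists g : 'I_n -> nat, [/\ injective g,
    forall z, z < n -> exists x, z = g x, forall x, g x < n,
    forall x y, mat A n v (g x) (g y) = adj G x y & root A n v = g v].
  have [f [fb fadj fv]] := iso0 v; have [f' fK f'K] := fb.
  exists (fun x => nat_of_ord (f x)); split.
  - by move=> x y /val_inj /(bij_inj fb).
  - move=> z zn; have zn' : z < nsize (X v) by rewrite sizeX.
    by exists (f' (Ordinal zn')); rewrite f'K.
  - by move=> x; rewrite -[X in _ < X](sizeX v).
  - by move=> x y; rewrite mat_encode // fadj.
  - by rewrite root_encode // fv.
have degE (v : 'I_n) g x : injective g -> (forall x, g x < n) ->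
    (forall x y, mat A n v (g x) (g y) = adj G x y) ->
    degr A n v (g x) = #|nbrs G x|.
  move=> ginj gn gm; rewrite /degr (sum_reindex_nat _ ginj gn) -sum1_card [RHS]big_mkcond.
  by apply: eq_bigr => y _; rewrite gm in_nbrs; case: (adj G x y).
have cntE (v : 'I_n) g x k : injective g -> (forall x, g x < n) ->
    (forall x y, mat A n v (g x) (g y) = adj G x y) ->
    cnt A n v (g x) k = nbr_degs G x k.
  move=> ginj gn gm; rewrite /cnt.
  rewrite (sum_reindex_nat (fun z => if degr A n v z == k then mat A n v (g x) z else 0) ginj gn).
  rewrite /nbr_degs -sum1_card [RHS]big_mkcond; apply: eq_bigr => y _.
  rewrite (degE _ _ _ ginj gn gm) gm !inE.
  by case: (adj G x y); case: (_ == k).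
have deg_lt x : #|nbrs G x| < n.
  rewrite -[X in _ < X](card_ord n) -cardsT proper_card //; apply/properP; split.
    exact: finset.subsetT.
  by exists x; rewrite ?inE // adj_irr.
(* the program compares the invariants only below n *)
have nbr0 x k : n <= k -> nbr_degs G x k = 0.
  move=> nk; apply: eq_card0 => y; rewrite finset.in_set; apply/negP => /andP[_ /eqP e].
  by have := deg_lt y; rewrite e; lia.
move=> i j; have [gi [gi_inj gi_sur gi_lt gi_mat gi_root]] := iso i.
have [gj [gj_inj _ gj_lt gj_mat gj_root]] := iso j.
have root_lt v : v < n -> root A n v < n.
  by move=> vn; have [g [_ _ gl _ gr]] := iso (Ordinal vn); rewrite gr.
rewrite (all_phases_spec root_lt) //.
have diffE x : (diff A n i j (gi x) == 0) = (x == j).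
  rewrite /diff gj_root sum_nat_eq0; apply/forallP/eqP => [h|-> k].
    apply: inj => k; case: (ltnP k n) => kn; last by rewrite !nbr0.
    have := h (Ordinal kn); rewrite implyTb /= (cntE _ _ _ _ gi_inj gi_lt gi_mat).
    by rewrite (cntE _ _ _ _ gj_inj gj_lt gj_mat); lia.
  rewrite implyTb (cntE _ _ _ _ gi_inj gi_lt gi_mat).
  by rewrite (cntE _ _ _ _ gj_inj gj_lt gj_mat) subnn.
have scanE m : m <= n -> scan A n i j m = if gi j < m then nat_of_bool (adj G i j) else 0.
  elim: m => // m IH mn; rewrite [LHS]/=.
  have [x mx] := gi_sur m mn; rewrite {1}mx diffE.
  case: eqP => [xj|xj]; first by rewrite -xj mx ltnSn gi_root gi_mat xj.
  rewrite IH; last exact: ltnW.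
  congr (if _ then _ else _); rewrite ltnS [RHS]leq_eqVlt.
  by case: eqP => // e; case: xj; apply: gi_inj; rewrite -mx.
by rewrite scanE // gi_lt.
Qed.

Lemma expnS_le n d : n.+1 ^ d <= 2 ^ d * n ^ d + 2 ^ d.
Proof.
case: n => [|n]; first by rewrite exp1n; have := expn_gt0 2 d; lia.
rewrite -expnMn; apply: leq_trans (leq_addr _ _).
by case: (posnP d) => [->|d0]; rewrite ?expn0 // leq_exp2r //; lia.
Qed.

Lemma program_polytime : polytime_on_nbhds 2 program.
Proof.
exists (4 + time_const all_phases * 2 ^ time_exp all_phases), (time_exp all_phases).
move=> n G X _; have [t ht bt] := @program_run (encode X) n (erefl _).
exists t; eexists; split; first exact: ht.
apply: leq_trans bt _; move: (time_const _) (time_exp _) => K d.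
have := leq_mul (leqnn K) (expnS_le n d); rewrite mulnDr mulnA mulnDl; lia.
Qed.

Local Open Scope ring_scope.

(** * Product Bernoulli measures *)

Section ProductMeasure.
Context {R : realType} {E : finType} (q : E -> R).

(** Slots carry individual probabilities so that some of them can be excluded by
    the value 0. *)
Definition weight (w : {set E}) : R :=
  \prod_e (if e \in w then q e else 1 - q e).

Definition Ex (F : {set E} -> R) : R := \sum_w weight w * F w.

Definition Pr (A : pred {set E}) : R := Ex (fun w => (A w)%:R).

(** Distributivity of the product over the sum of two cases for every slot. *)
Lemma Ex_prod_slots (g : E -> bool -> R) :
  Ex (fun w => \prod_e g e (e \in w)) =
  \prod_e (q e * g e true + (1 - q e) * g e false).
Proof.
rewrite bigA_distr; apply: eq_bigr => w _; rewrite -big_split /=.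
by apply: eq_bigr => e _; case: ifP.
Qed.

Lemma weight_sum1 : \sum_w weight w = 1.
Proof.
transitivity (\prod_e (q e + (1 - q e))); first by rewrite bigA_distr.
by apply: big1 => e _; rewrite addrC subrK.
Qed.

Lemma Ex_cst c : Ex (fun=> c) = c.
Proof. by rewrite /Ex -mulr_suml weight_sum1 mul1r. Qed.

Lemma eq_Ex F G : F =1 G -> Ex F = Ex G.
Proof. by move=> FG; apply: eq_bigr => w _; rewrite FG. Qed.

Lemma ExD F G : Ex (fun w => F w + G w) = Ex F + Ex G.
Proof. by rewrite -big_split; apply: eq_bigr => w _; rewrite mulrDr. Qed.

Lemma ExZ c F : Ex (fun w => c * F w) = c * Ex F.
Proof. by rewrite /Ex mulr_sumr; apply: eq_bigr => w _; rewrite mulrCA. Qed.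

Lemma Ex_sum (I : finType) (P : pred I) (F : I -> {set E} -> R) :
  Ex (fun w => \sum_(i | P i) F i w) = \sum_(i | P i) Ex (F i).
Proof.
rewrite exchange_big; apply: eq_bigr => w _.
by rewrite mulr_sumr.
Qed.

Lemma Pr_slot (e0 : E) : Pr (fun w => e0 \in w) = q e0.
Proof.
rewrite /Pr.
rewrite (@eq_Ex _ (fun w => \prod_e (if e == e0 then (e \in w)%:R else 1))); last first.
  by move=> w; rewrite -big_mkcond big_pred1_eq.
rewrite (Ex_prod_slots (fun e b => if e == e0 then b%:R else 1)).
rewrite (bigD1 e0) //= eqxx mulr1 mulr0 addr0 big1 ?mulr1 // => e /negPf ->.
by rewrite !mulr1 addrC subrK.
Qed.

Lemma Pr_predC (A : pred {set E}) : Pr (fun w => ~~ A w) = 1 - Pr A.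
Proof.
rewrite -{1}(Ex_cst 1) -[RHS]addrC -mulN1r -ExZ -ExD.
by apply: eq_Ex => w /=; case: (A w) => /=; lra.
Qed.

Definition merge (S w w' : {set E}) := (w :\: S) :|: (w' :&: S).

Lemma in_merge S w w' e :
  (e \in merge S w w') = if e \in S then e \in w' else e \in w.
Proof. by rewrite !inE; case: (e \in S); rewrite ?andbT ?andbF ?orbF. Qed.

Lemma weight_merge S w w' :
  weight (merge S w w') * weight (merge S w' w) = weight w * weight w'.
Proof.
rewrite -!big_split; apply: eq_bigr => e _ /=; rewrite !in_merge.
by case: (e \in S) => //; rewrite mulrC.
Qed.

(** Two independent configurations may swap their parts inside [S]: this is an
    involution of the pairs that preserves their weight.  So replacing the part
    of [w] inside [S] by a fresh sample does not change expectations, which is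
    Fubini's theorem for the splitting of the slots into [S] and the rest. *)
Lemma Ex_resample S F : Ex F = Ex (fun w => Ex (fun w' => F (merge S w w'))).
Proof.
rewrite -[LHS]mulr1 -weight_sum1 big_distrl /=.
transitivity (\sum_(u : {set E} * {set E}) weight u.1 * weight u.2 * F u.1).
  rewrite -(pair_bigA _ (fun w w' => weight w * weight w' * F w)) /=.
  apply: eq_bigr => w _; rewrite mulr_sumr; apply: eq_bigr => w' _.
  by rewrite mulrAC.
pose h (u : {set E} * {set E}) := (merge S u.1 u.2, merge S u.2 u.1).
have hK : involutive h.
  move=> [w w']; rewrite /h /=; congr pair; apply/setP => e;
  by rewrite !in_merge; case: (e \in S).
rewrite (reindex_inj (inv_inj hK)) /=.
under eq_bigr do rewrite weight_merge.
rewrite -(pair_bigA _ (fun w w' => weight w * weight w' * F (merge S w w'))) /=.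
apply: eq_bigr => w _; rewrite /Ex mulr_sumr; apply: eq_bigr => w' _.
by rewrite mulrA.
Qed.

Definition depends_on (T : Type) (S : {set E}) (F : {set E} -> T) :=
  forall w w' : {set E}, {in S, w =i w'} -> F w = F w'.

Lemma depends_onS T (S S' : {set E}) (F : {set E} -> T) :
  S \subset S' -> depends_on S F -> depends_on S' F.
Proof. by move=> /subsetP sS dF w w' eqw; apply: dF => e /sS; exact: eqw. Qed.

Lemma depends_on_in (e : E) (S : {set E}) :
  e \in S -> depends_on S (fun w => e \in w).
Proof. by move=> eS w w' ->. Qed.

Lemma ExM_indep (S S' : {set E}) F G :
  [disjoint S & S'] -> depends_on S F -> depends_on S' G ->
  Ex (fun w => F w * G w) = Ex F * Ex G.
Proof.
move=> dis dF dG; rewrite (Ex_resample S).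
transitivity (Ex (fun w => Ex F * G w)); last by rewrite ExZ.
apply: eq_Ex => w.
transitivity (Ex (fun w' => G w * F w')); last by rewrite ExZ mulrC.
apply: eq_Ex => w'; rewrite mulrC; congr (_ * _).
  by apply: dG => e eS'; rewrite in_merge (disjointFl dis eS').
by apply: dF => e eS; rewrite in_merge eS.
Qed.

Lemma Ex_prod_indep (I : finType) (P : pred I) (S : I -> {set E})
    (F : I -> {set E} -> R) :
  (forall i j, P i -> P j -> i != j -> [disjoint S i & S j]) ->
  (forall i, P i -> depends_on (S i) (F i)) ->
  Ex (fun w => \prod_(i | P i) F i w) = \prod_(i | P i) Ex (F i).
Proof.
move=> dis dF.
under eq_Ex do rewrite -big_filter.
rewrite -[in RHS]big_filter.
have: {subset filter P (index_enum I) <= [pred i | P i]}.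
  by move=> i; rewrite mem_filter => /andP[].
have: uniq (filter P (index_enum I)) by rewrite filter_uniq ?index_enum_uniq.
elim: (filter P _) => [_ _|i r IH /= /andP[ir ur] sP].
  by rewrite big_nil -[RHS]Ex_cst; apply: eq_Ex => w; rewrite big_nil.
rewrite big_cons -IH //; last by move=> j jr; apply: sP; rewrite inE jr orbT.
under eq_Ex do rewrite big_cons.
have Pi : P i by apply: sP; rewrite inE eqxx.
have Pr' j : j \in r -> P j by move=> jr; apply: sP; rewrite inE jr orbT.
apply: (@ExM_indep (S i) (\bigcup_(j in r) S j)); first 1 last.
- exact: dF.
- move=> w w' eqw; apply: eq_big_seq => j jr; apply: dF (Pr' _ jr) _ _ _.
  by move=> e eS; apply: eqw; apply/bigcupP; exists j.
- apply/pred0P => e; apply/negP => /= /andP[eSi /bigcupP[j jr eSj]].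
  have ij : i != j by apply: contraNneq ir => ->.
  by rewrite (disjointFr (dis _ _ Pi (Pr' _ jr) ij) eSi) in eSj.
Qed.

Context (q01 : forall e, 0 <= q e <= 1).

Lemma weight_ge0 w : 0 <= weight w.
Proof.
apply: prodr_ge0 => e _; have /andP[? ?] := q01 e.
by case: ifP => _; rewrite ?subr_ge0.
Qed.

Lemma le_Ex F G : (forall w, F w <= G w) -> Ex F <= Ex G.
Proof. by move=> FG; apply: ler_sum => w _; rewrite ler_wpM2l ?weight_ge0. Qed.

Lemma Ex_ge0 F : (forall w, 0 <= F w) -> 0 <= Ex F.
Proof. by move=> F0; rewrite -(Ex_cst 0); apply: le_Ex. Qed.

Lemma Pr_ge0 A : 0 <= Pr A. Proof. by apply: Ex_ge0 => w; rewrite ler0n. Qed.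

Lemma Pr_le1 A : Pr A <= 1.
Proof. by rewrite -(Ex_cst 1); apply: le_Ex => w; rewrite lern1; case: (A w). Qed.

Lemma le_Pr (A B : pred {set E}) : (forall w, A w -> B w) -> Pr A <= Pr B.
Proof. by move=> AB; apply: le_Ex => w; rewrite ler_nat; case: (A w) (AB w) => // ->. Qed.

Lemma Pr_union (I : finType) (P : pred I) (A : I -> pred {set E}) :
  Pr (fun w => [exists i, P i && A i w]) <= \sum_(i | P i) Pr (A i).
Proof.
rewrite -Ex_sum; apply: le_Ex => w.
case: existsP => [[i /andP[Pi Ai]]|_]; last by apply: sumr_ge0 => i _.
by rewrite (bigD1 i) //= Ai lerDl; apply: sumr_ge0 => j _.
Qed.

Lemma Pr_union_card (I : finType) (P : pred I) (A : I -> pred {set E}) (b : R) :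
  0 <= b -> (forall i, P i -> Pr (A i) <= b) ->
  Pr (fun w => [exists i, P i && A i w]) <= #|I|%:R * b.
Proof.
move=> b0 Ab; apply: le_trans (Pr_union _ _) _.
apply: (@le_trans _ _ (\sum_(i | P i) b)); first exact: ler_sum.
by rewrite sumr_const -[X in X <= _]mulr_natl ler_wpM2r // ler_nat max_card.
Qed.

Lemma Pr_orB (A B : pred {set E}) : Pr (fun w => A w || B w) <= Pr A + Pr B.
Proof.
rewrite -ExD; apply: le_Ex => w; rewrite -natrD ler_nat.
by case: (A w); case: (B w).
Qed.

(** Conditioning: it suffices to bound the probability once the configuration
    outside [S] has been fixed. *)
Lemma Pr_resample_le (S : {set E}) (A : pred {set E}) (b : R) :
  (forall w, Pr (fun w' => A (merge S w w')) <= b) -> Pr A <= b.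
Proof.
by move=> h; rewrite /Pr (Ex_resample S) -(Ex_cst b); apply: le_Ex.
Qed.

Lemma Markov (F : {set E} -> R) (A : pred {set E}) (c : R) :
  (forall w, 0 <= F w) -> 0 < c -> (forall w, A w -> c <= F w) ->
  Pr A <= Ex F / c.
Proof.
move=> F0 c0 AF; rewrite ler_pdivlMr // mulrC -ExZ; apply: le_Ex => w.
by case: (boolP (A w)) => [/AF|_]; rewrite ?mulr1 ?mulr0.
Qed.

Section Blocks.
Context (I : finType) (P : pred I) (S : I -> {set E}) (X : I -> pred {set E}).
Context (dis : forall i j, P i -> P j -> i != j -> [disjoint S i & S j]).
Context (dX : forall i, P i -> depends_on (S i) (X i)).

(** Both tails of this variable come from its exponential moments, which
    factorize as the events are independent. *)
Definition hits (w : {set E}) : nat := #|[pred i | P i && X i w]|.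

Lemma Ex_pow_hits (s : R) :
  Ex (fun w => (1 + s) ^+ hits w) = \prod_(i | P i) (1 + s * Pr (X i)).
Proof.
transitivity (Ex (fun w => \prod_(i | P i) (1 + s * (X i w)%:R))).
  apply: eq_Ex => w; rewrite /hits -prodr_const.
  rewrite big_mkcondr; apply: eq_bigr => i _.
  by rewrite /in_mem /=; case: (X i w); rewrite ?mulr1 ?mulr0 ?addr0.
rewrite (Ex_prod_indep dis); last first.
  by move=> i Pi w w' /(dX Pi) ->.
by apply: eq_bigr => i _; rewrite ExD Ex_cst ExZ.
Qed.

Lemma Ex_pow_hits_le (s mu : R) : -1 <= s -> 
  (s * \sum_(i | P i) Pr (X i) <= s * mu) ->
  Ex (fun w => (1 + s) ^+ hits w) <= expR (s * mu).
Proof.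
move=> s1 hmu; rewrite Ex_pow_hits.
apply: le_trans (_ : expR (s * \sum_(i | P i) Pr (X i)) <= _); last first.
  by rewrite ler_expR.
rewrite mulr_sumr expR_sum; apply: ler_prod => i Pi.
rewrite expR_ge1Dx andbT.
have := Pr_ge0 (X i); have := Pr_le1 (X i).
by nra.
Qed.

(** Markov's inequality for [2^-1 ^+ hits], that is the exponential moment at
    [s = -1/2], together with [2 <= e]. *)
Lemma lower_tail (mu t : R) : mu <= \sum_(i | P i) Pr (X i) ->
  Pr (fun w => (hits w)%:R <= t) <= expR (t - mu / 2).
Proof.
move=> hmu.
have h := @Ex_pow_hits_le (- 2^-1) mu _ _.
apply: le_trans (Markov (F := fun w => (1 - 2^-1) ^+ hits w)
   (c := expR (- t)) _ _ _) _.
- by move=> w; apply: exprn_ge0; lra.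
- exact: expR_gt0.
- move=> w ht.
  have -> : 1 - 2^-1 = 2^-1 :> R by lra.
  rewrite exprVn.
  apply: le_trans (_ : expR (- (hits w)%:R) <= _).
    by rewrite ler_expR lerN2.
  rewrite expRN lef_pV2 ?posrE ?expR_gt0 ?exprn_gt0 //.
  rewrite -[X in expR X]mulr1 expRM_natl lerXn2r ?nnegrE ?expR_ge0 //.
  by have := expR_ge1Dx (1 : R); lra.
- rewrite ler_pdivrMr ?expR_gt0 // -expRD.
  have -> : t - mu / 2 + - t = - 2^-1 * mu by lra.
  by apply: h; [lra|nra].
Qed.

Lemma upper_tail (mu s : R) (t : nat) : 0 <= s -> \sum_(i | P i) Pr (X i) <= mu ->
  Pr (fun w => (t <= hits w)%N) <= expR (s * mu) / (1 + s) ^+ t.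
Proof.
move=> s0 hmu.
have h := @Ex_pow_hits_le s mu _ _.
apply: le_trans (Markov (F := fun w => (1 + s) ^+ hits w)
   (c := (1 + s) ^+ t) _ _ _) _.
- by move=> w; apply: exprn_ge0; lra.
- by apply: exprn_gt0; lra.
- by move=> w ht; rewrite ler_weXn2l //; lra.
- rewrite ler_pM2r; last by rewrite invr_gt0 exprn_gt0 //; lra.
  by apply: h; [lra|rewrite ler_wpM2l].
Qed.

End Blocks.

Lemma count_lower (I : finType) (P : pred I) (S : I -> {set E})
    (X : I -> pred {set E}) (N : {set E} -> nat) (mu t : R) :
  (forall i j, P i -> P j -> i != j -> [disjoint S i & S j]) ->
  (forall i, P i -> depends_on (S i) (X i)) ->
  mu <= \sum_(i | P i) Pr (X i) ->
  (forall w, #|[pred i | P i && X i w]| <= N w)%N ->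
  Pr (fun w => (N w)%:R <= t) <= expR (t - mu / 2).
Proof.
move=> dis dX hmu hN; apply: le_trans (lower_tail dis dX t hmu).
by apply: le_Pr => w; apply: le_trans; rewrite ler_nat; apply: hN.
Qed.

Lemma count_upper (I : finType) (P : pred I) (S : I -> {set E})
    (X : I -> pred {set E}) (N : {set E} -> nat) (mu s : R) (t : nat) :
  0 <= s ->
  (forall i j, P i -> P j -> i != j -> [disjoint S i & S j]) ->
  (forall i, P i -> depends_on (S i) (X i)) ->
  \sum_(i | P i) Pr (X i) <= mu ->
  (forall w, N w <= #|[pred i | P i && X i w]|)%N ->
  Pr (fun w => (t <= N w)%N) <= expR (s * mu) / (1 + s) ^+ t.
Proof.
move=> s0 dis dX hmu hN; apply: le_trans (upper_tail dis dX t s0 hmu).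
by apply: le_Pr => w h; apply: leq_trans (hN w).
Qed.
End ProductMeasure.

(** * The random graph as a product measure *)

Section SlotMeasure.
Context {R : realType} {T : finType}.

(** All sets of vertices are slots; those that are not pairs get probability 0,
    so the measure is carried by the edge sets of graphs. *)
Definition slot_prob (p : R) (e : {set T}) : R := if #|e| == 2%N then p else 0.

Lemma slot_prob01 p : 0 <= p <= 1 -> forall e, 0 <= slot_prob p e <= 1.
Proof. by move=> p01 e; rewrite /slot_prob; case: ifP => // _; rewrite lexx ler01. Qed.

Lemma weight_slot (p : R) (w : {set {set T}}) :
  weight (slot_prob p) w =
  (\prod_(e : {set T} | #|e| == 2%N) (if e \in w then p else 1 - p)) *
  (w \subset [set e : {set T} | #|e| == 2%N])%:R.
Proof.
rewrite /weight (bigID (fun e : {set T} => #|e| == 2%N)) /=; congr (_ * _).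
  by apply: eq_bigr => e e2; rewrite /slot_prob e2.
have [/fintype.subsetP sw|] := boolP (w \subset _).
  rewrite big1 // => e e2; rewrite /slot_prob (negPf e2) subr0.
  by case: ifP => // /sw; rewrite inE (negPf e2).
case/subsetPn => e ew; rewrite inE => e2.
by rewrite (bigD1 e) //= ew /slot_prob (negPf e2) mul0r.
Qed.

End SlotMeasure.

Lemma Gnp_probE (R : realType) (n : nat) (p : R) (E : sgraph 'I_n -> Prop) :
  Gnp_prob p E = Pr (slot_prob p) (fun w => `[< E (graph_of w) >]).
Proof.
rewrite /Gnp_prob big_mkcond /=.
transitivity (\sum_(G : sgraph 'I_n) weight (slot_prob p) (edges G) *
    (`[< E (graph_of (edges G)) >])%:R).
  apply: eq_bigr => G _; rewrite weight_slot graph_of_edges.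
  have -> : edges G \subset [set e : {set 'I_n} | #|e| == 2%N].
    by apply/fintype.subsetP => e eG; rewrite inE (forall_inP (edges_card2 G)).
  by rewrite mulr1; case: ifP => _; rewrite ?mulr1 ?mulr0.
rewrite /Pr /Ex.
rewrite [RHS](bigID [pred w : {set {set 'I_n}} | w \subset [set e : {set 'I_n} | #|e| == 2%N]]) /=.
rewrite [X in _ = _ + X]big1 ?addr0; last first.
  by move=> w /negPf ws; rewrite weight_slot ws mulr0 mul0r.
rewrite [RHS](reindex_onto (@edges 'I_n) (@graph_of 'I_n)) /=; last first.
  move=> w /fintype.subsetP ws; apply/setP => e; rewrite inE.
  by case ew: (e \in w) => //=; have := ws _ ew; rewrite inE.
apply: eq_bigl => G; rewrite graph_of_edges eqxx andbT; apply/esym.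
by apply/fintype.subsetP => e eG; rewrite inE (forall_inP (edges_card2 G)).
Qed.

(** * Tail bounds for the random graph *)

Section Tails.
Context {R : realType} {T : finType} (p : R).
Context (p01 : 0 <= p <= 1).
Notation P := (Pr (@slot_prob R T p)).
Let q01 := @slot_prob01 R T p p01.
Implicit Types (w : {set {set T}}) (x y z u v : T).

Lemma Pr_slot_in x y : x != y -> P (fun w => slot x y \in w) = p.
Proof. by move=> xy; rewrite Pr_slot /slot_prob card_slot. Qed.

Lemma Pr_and_indep (S S' : {set {set T}}) (A B : pred {set {set T}}) :
  [disjoint S & S'] -> depends_on S A -> depends_on S' B ->
  P (fun w => A w && B w) = P A * P B.
Proof.
move=> dis dA dB; rewrite -(ExM_indep _ dis).
- by apply: eq_Ex => w; rewrite -natrM mulnb.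
- by move=> w w' /dA ->.
- by move=> w w' /dB ->.
Qed.

Lemma depends_on_slot x y : depends_on [set slot x y] (fun w => slot x y \in w).
Proof. by apply: depends_on_in; rewrite inE. Qed.

Lemma Pr_slot_and x y u v : x != y -> u != v -> slot x y != slot u v ->
  P (fun w => (slot x y \in w) && (slot u v \in w)) = p * p.
Proof.
move=> xy uv ne; rewrite (Pr_and_indep (S := [set slot x y]) (S' := [set slot u v])).
- by rewrite !Pr_slot_in.
- by rewrite disjoints1 inE.
- exact: depends_on_slot.
- exact: depends_on_slot.
Qed.

Lemma Pr_slot_xor x y u v : x != y -> u != v -> slot x y != slot u v ->
  P (fun w => (slot x y \in w) != (slot u v \in w)) = 2 * (p * (1 - p)).
Proof.
move=> xy uv ne.
transitivity (P (fun w => slot x y \in w) + (P (fun w => slot u v \in w) +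
   - 2 * P (fun w => (slot x y \in w) && (slot u v \in w)))).
  rewrite /P -ExZ -!ExD; apply: eq_Ex => w.
  by case: (slot x y \in w); case: (slot u v \in w) => /=; ring.
by rewrite !Pr_slot_in // Pr_slot_and //; ring.
Qed.

Lemma sumr_const_pred (I : finType) (Q : pred I) (c : R) :
  \sum_(i | Q i) c = #|Q|%:R * c.
Proof. by rewrite sumr_const mulr_natl. Qed.

Lemma nbrs_lower x (U : {set T}) (a : R) : x \notin U ->
  P (fun w => #|nbrs (graph_of w) x :&: U|%:R <= a) <= expR (a - #|U|%:R * p / 2).
Proof.
move=> xU; have neq z : z \in U -> x != z.
  by apply: contraTneq => <-.
apply: (count_lower q01 (P := mem U) (S := fun z => [set slot x z])
    (X := fun z w => slot x z \in w)).
- by move=> i j iU jU ij; rewrite disjoints1 inE slot_inj.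
- by move=> i _; apply: depends_on_slot.
- rewrite -sumr_const_pred; apply: ler_sum => i iU.
  by rewrite Pr_slot_in ?neq.
- move=> w; apply: eq_leq; apply: eq_card => z.
  rewrite [LHS]inE finset.in_setI in_nbrs adj_graph_of -[mem U z]/(z \in U) andbC.
  by case zU: (z \in U); rewrite ?andbF // neq.
Qed.

Lemma nbrs_upper x (s : R) (t : nat) : 0 <= s ->
  P (fun w => (t <= #|nbrs (graph_of w) x|)%N) <=
    expR (s * (#|T|%:R * p)) / (1 + s) ^+ t.
Proof.
move=> s0.
apply: (count_upper q01 (P := [pred z | x != z])
    (S := fun z => [set slot x z]) (X := fun z w => slot x z \in w)) => //.
- by move=> i j /= iU jU ij; rewrite disjoints1 inE slot_inj.
- by move=> i _; apply: depends_on_slot.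
- rewrite (eq_bigr (fun=> p)); last by move=> i xi; rewrite Pr_slot_in.
  rewrite sumr_const_pred ler_wpM2r ?ler_nat ?max_card //.
  by case/andP: p01.
- move=> w; apply: eq_leq.
  by apply: eq_card => z; rewrite !inE adj_graph_of.
Qed.

Lemma disjoint_slot2 x y i j : x != y -> i != x -> i != y -> j != x -> j != y ->
  i != j -> [disjoint [set slot x i; slot y i] & [set slot x j; slot y j]]%SET.
Proof.
move=> xy ix iy jx jy ij.
apply/pred0P => e; apply/negP => /= /andP[]; rewrite !inE.
case/orP => /eqP->; rewrite slot_inj (negPf ij) ?orbF /=; apply/negP.
  by apply: slot_neq; rewrite // eq_sym.
by apply: slot_neq; rewrite // eq_sym.
Qed.

Lemma slot2_neq x y z : x != y -> z != x -> slot x z != slot y z.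
Proof.
by move=> xy zx; apply: slot_neq; rewrite // eq_sym.
Qed.

Lemma conbrs_upper x y (s : R) (t : nat) : 0 <= s -> x != y ->
  P (fun w => (t <= #|conbrs (graph_of w) x y|)%N) <=
    expR (s * (#|T|%:R * (p * p))) / (1 + s) ^+ t.
Proof.
move=> s0 xy.
apply: (count_upper q01 (P := [pred z | (z != x) && (z != y)])
    (S := fun z => [set slot x z; slot y z]%SET)
    (X := fun z w => (slot x z \in w) && (slot y z \in w))) => //.
- move=> i j /andP[ix iy] /andP[jx jy] ij; exact: disjoint_slot2.
- by move=> z _ w w' e; rewrite !e // !inE eqxx ?orbT.
- rewrite (eq_bigr (fun=> p * p)).
    rewrite sumr_const_pred ler_wpM2r ?ler_nat ?max_card //.
    by case/andP: p01 => p0 _; apply: mulr_ge0.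
  move=> z /andP[zx zy].
  by rewrite Pr_slot_and ?slot2_neq // eq_sym.
- move=> w; apply: eq_leq.
  apply: eq_card => z; rewrite !inE !adj_graph_of [x == z]eq_sym [y == z]eq_sym.
  by case: (z != x); case: (z != y); rewrite ?andbF.
Qed.

Lemma conbrs_none x y : x != y ->
  P (fun w => #|conbrs (graph_of w) x y| == 0%N) <=
    expR (- ((#|T|%:R - 2) * (p * p) / 2)).
Proof.
move=> xy; rewrite -[X in expR X]add0r.
apply: le_trans (_ : P (fun w => #|conbrs (graph_of w) x y|%:R <= 0) <= _).
  by apply: (le_Pr q01) => w /eqP->.
apply: (count_lower q01 (P := [pred z | (z != x) && (z != y)])
    (S := fun z => [set slot x z; slot y z]%SET)
    (X := fun z w => (slot x z \in w) && (slot y z \in w))).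
- move=> i j /andP[ix iy] /andP[jx jy] ij; exact: disjoint_slot2.
- by move=> z _ w w' e; rewrite !e // !inE eqxx ?orbT.
- rewrite (eq_bigr (fun=> p * p)); last first.
    move=> z /andP[zx zy].
    by rewrite Pr_slot_and ?slot2_neq // eq_sym.
  rewrite sumr_const_pred ler_wpM2r //.
    by case/andP: p01 => p0 _; apply: mulr_ge0.
  rewrite lerBlDr -natrD ler_nat.
  rewrite -(cardC (mem [set x; y]%SET)) cards2 xy addnC leq_add2r.
  by apply: subset_leq_card; apply/fintype.subsetP => z; rewrite !inE negb_or.
- move=> w; apply: eq_leq.
  apply: eq_card => z; rewrite !inE !adj_graph_of [x == z]eq_sym [y == z]eq_sym.
  by case: (z != x); case: (z != y); rewrite ?andbF.
Qed.

(** Only the [h * h] pairs between the first and the second half of the indices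
    are used: on these, [f] and [g] give distinct slots, all independent, and
    two independent slots disagree with probability [2 p (1 - p) >= p]. *)
Lemma twins_upper h (f g : {ffun 'I_(h + h) -> T}) : p <= 2^-1 ->
  injective f -> injective g -> (forall i j, f i != g j) ->
  P (fun w => [forall i, forall j, adj (graph_of w) (f i) (f j) ==
                                   adj (graph_of w) (g i) (g j)]) <=
  expR (- ((h * h)%:R * p / 2)).
Proof.
move=> p2 finj ginj fg; rewrite -[X in expR X]add0r.
pose l (i : 'I_h) := lshift h i; pose r (i : 'I_h) := rshift h i.
have lr i j : l i != r j by rewrite /l /r eq_lrshift.
have flr i j : f (l i) != f (r j) by rewrite (inj_eq finj).
have glr i j : g (l i) != g (r j) by rewrite (inj_eq ginj).
pose F (ij : 'I_h * 'I_h) := slot (f (l ij.1)) (f (r ij.2)).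
pose G (ij : 'I_h * 'I_h) := slot (g (l ij.1)) (g (r ij.2)).
have FG a b : F a != G b.
  by rewrite /F /G slot_eq // !(negPf (fg _ _)).
have Finj a b : a != b -> F a != F b.
  move=> ab; rewrite /F slot_eq // !(inj_eq finj) /l /r !eq_lrshift.
  rewrite (inj_eq (@lshift_inj _ _)) (inj_eq (@rshift_inj _ _)) /= orbF.
  by move: ab; case: a => a1 a2; case: b => b1 b2; rewrite xpair_eqE.
have Ginj a b : a != b -> G a != G b.
  move=> ab; rewrite /G slot_eq // !(inj_eq ginj) /l /r !eq_lrshift.
  rewrite (inj_eq (@lshift_inj _ _)) (inj_eq (@rshift_inj _ _)) /= orbF.
  by move: ab; case: a => a1 a2; case: b => b1 b2; rewrite xpair_eqE.
pose N (w : {set {set T}}) := #|[pred ij | (F ij \in w) != (G ij \in w)]|.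
apply: le_trans (_ : P (fun w => (N w)%:R <= 0) <= _).
  apply: (le_Pr q01) => w /forallP h0.
  rewrite (_ : N w = 0%N) //; apply: eq_card0 => -[i j].
  have /forallP/(_ (r j))/eqP := h0 (l i).
  by rewrite !adj_graph_of flr glr /= !inE /F /G /= /slot => ->; rewrite eqxx.
apply: (count_lower q01 (P := predT)
    (S := fun ij => [set F ij; G ij]%SET)
    (X := fun ij w => (F ij \in w) != (G ij \in w))); last by [].
- move=> a b _ _ ab; apply/pred0P => e; apply/negP => /= /andP[]; rewrite !inE.
  case/orP => /eqP->; rewrite ?(negPf (Finj _ _ ab)) ?(negPf (Ginj _ _ ab)) ?(negPf (FG _ _)) //.
  by rewrite orbF eq_sym (negPf (FG _ _)).
- by move=> a _ w w' e; rewrite !e // !inE eqxx ?orbT.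
- rewrite (eq_bigr (fun=> 2 * (p * (1 - p)))); last first.
    by move=> a _; rewrite Pr_slot_xor //; apply: FG.
  rewrite sumr_const_pred (_ : #|_| = (h * h)%N); last first.
    by rewrite card_prod card_ord.
  by rewrite ler_wpM2l ?ler0n //; case/andP: p01 => *; nra.
Qed.

(** A union bound over the at most [#|T| ^ (4 h)] pairs of tuples. *)
Lemma twin_free_likely h : p <= 2^-1 ->
  P (fun w => `[< ~ twin_free (h + h) (graph_of w) >]) <=
  #|T|%:R ^+ (4 * h) * expR (- ((h * h)%:R * p / 2)).
Proof.
move=> p2.
pose ok (fg : {ffun 'I_(h + h) -> T} * {ffun 'I_(h + h) -> T}) :=
  [&& injectiveb fg.1, injectiveb fg.2 & [forall i, forall j, fg.1 i != fg.2 j]].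
apply: le_trans (_ : P (fun w => [exists fg, ok fg &&
  [forall i, forall j, adj (graph_of w) (fg.1 i) (fg.1 j) ==
                       adj (graph_of w) (fg.2 i) (fg.2 j)]]) <= _).
  apply: (le_Pr q01) => w /asboolP ntf; apply/existsP.
  apply: contrapT => no; apply: ntf => f g finj ginj fg eqfg; apply: no.
  exists (f, g); rewrite /ok /=; apply/andP; split.
    rewrite (introT (injectiveP f) finj) (introT (injectiveP g) ginj) /=.
    by apply/forallP => i; apply/forallP => j.
  by apply/forallP => i; apply/forallP => j; rewrite eqfg.
apply: le_trans (Pr_union_card q01 (b := expR (- ((h * h)%:R * p / 2))) _ _) _.
- exact: expR_ge0.
- move=> [f g] /= /and3P[/injectiveP finj /injectiveP ginj /forallP fg].
  by apply: twins_upper => // i j; have /forallP := fg i; apply.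
- rewrite ler_wpM2r ?expR_ge0 // -natrX ler_nat.
  by rewrite card_prod card_ffun card_ord -expnD leq_eqVlt; apply/orP; left; apply/eqP; congr (_ ^ _)%N; lia.
Qed.

Lemma expRN_le (y : R) : 0 <= y <= 1 -> expR (- y) <= 1 - y / 2.
Proof.
move=> /andP[y0 y1]; rewrite expRN.
apply: (@le_trans _ _ (1 + y)^-1).
  by rewrite lef_pV2 ?posrE ?expR_gt0 ?expR_ge1Dx //; lra.
have y2 : 0 < 1 + y by lra.
rewrite -[leLHS]mul1r ler_pdivrMr //.
nra.
Qed.

(** The probability of having no neighbour in [A] is at most [expR (- (a p / 2))],
    which is at most [1 - a p / 4] while [a p <= 2]. *)
Lemma exists_nbr_lower x (A : {set T}) (a : R) : x \notin A ->
  0 <= a <= #|A|%:R -> a * p <= 2 ->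
  a * p / 4 <= P (fun w => [exists z in A, slot x z \in w]).
Proof.
move=> xA /andP[a0 aA] ap2; have /andP[p0 _] := p01.
have : P (fun w => ~~ [exists z in A, slot x z \in w]) <= expR (- (a * p / 2)).
  apply: le_trans (_ : P (fun w => #|nbrs (graph_of w) x :&: A|%:R <= 0) <= _).
    apply: (le_Pr q01) => w /existsPn h.
    rewrite (_ : #|_| = 0%N) //; apply: eq_card0 => z.
    rewrite finset.inE in_nbrs adj_graph_of; apply: contraNF (h z).
    by case/andP => /andP[_ zw] zA; rewrite zA.
  apply: le_trans (nbrs_lower _ xA) _.
  by rewrite ler_expR sub0r lerN2 !ler_wpM2r.
rewrite (Pr_predC _ (fun w => [exists z in A, slot x z \in w])).
have y0 : 0 <= a * p by apply: mulr_ge0.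
have : expR (- (a * p / 2)) <= 1 - a * p / 2 / 2 by apply: expRN_le; lra.
by lra.
Qed.

(** First reveal the edges from [v] to [U1] and from [u] to [U3]; with high
    probability they lead to sets [A] and [B] of more than [a] vertices.  All
    edges between [U2] and the other two sets are still independent, and each
    vertex of [U2] is joined to both [A] and [B], which puts it into the
    overlap, with probability at least [(a p / 4)^2]. *)
Lemma overlap_lower v u (U1 U2 U3 : {set T}) (m : nat) (a t : R) :
  v != u -> v \notin U1 :|: U2 :|: U3 -> u \notin U1 :|: U2 :|: U3 ->
  [disjoint U1 & U2] -> [disjoint U3 & U2] -> [disjoint U1 & U3] ->
  (m <= #|U1|)%N -> (m <= #|U2|)%N -> (m <= #|U3|)%N ->
  0 <= a -> a * p <= 2 ->
  P (fun w => #|overlap (graph_of w) v u|%:R <= t) <=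
  2 * expR (a - m%:R * p / 2) +
  expR (t - m%:R * ((a * p / 4) * (a * p / 4)) / 2).
Proof.
move=> vu; rewrite !finset.in_setU !negb_or -!andbA => /and3P[v1 v2 v3] /and3P[u1 u2 u3].
move=> d12 d32 d13 m1 m2 m3 a0 ap2; have /andP[p0 _] := p01.
have y0 : 0 <= a * p / 4 by rewrite divr_ge0 // mulr_ge0.
pose A w := nbrs (graph_of w) v :&: U1.
pose B w := nbrs (graph_of w) u :&: U3.
pose E2 w := [&& a < #|A w|%:R, a < #|B w|%:R & #|overlap (graph_of w) v u|%:R <= t].
have step1 : P (fun w => #|overlap (graph_of w) v u|%:R <= t) <=
    P (fun w => #|A w|%:R <= a) + (P (fun w => #|B w|%:R <= a) + P E2).
  apply: le_trans (le_trans (Pr_orB q01 _ _) (lerD (lexx _) (Pr_orB q01 _ _))).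
  apply: (le_Pr q01) => w ht; rewrite /E2 ht andbT.
  by case: (leP _ a) => //= _; case: (leP _ a).
apply: le_trans step1 _.
have expm (U : {set T}) : (m <= #|U|)%N -> expR (a - #|U|%:R * p / 2) <= expR (a - m%:R * p / 2).
  by move=> mU; rewrite ler_expR lerD2l lerN2 !ler_wpM2r ?ler_nat.
rewrite [2 * _]mulr_natl mulr2n -addrA; apply: lerD.
  exact: le_trans (nbrs_lower _ v1) (expm _ m1).
apply: lerD; first exact: le_trans (nbrs_lower _ u3) (expm _ m3).
(* the edges that remain to be revealed once A and B are known *)
pose S := [set slot c.1 c.2 | c in finset.setX (U1 :|: U3) U2]%SET.
have slS x y : x \notin U1 :|: U3 -> x \notin U2 -> slot x y \notin S.
  move=> x13 x2; apply/negP => /imsetP[[c d]]; rewrite in_setX => /andP[c13 d2].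
  apply/eqP; apply: slot_neq; first by apply: contraNneq x13 => ->.
  by apply: contraNneq x2 => ->.
apply: (Pr_resample_le q01 (S := S)) => w.
have AE w' : A (merge S w w') = A w.
  apply/setP => z; rewrite !inE !adj_graph_of in_merge -/(slot v z).
  by rewrite (negPf (slS v z _ _)) // !inE negb_or v1.
have BE w' : B (merge S w w') = B w.
  apply/setP => z; rewrite !inE !adj_graph_of in_merge -/(slot u z).
  by rewrite (negPf (slS u z _ _)) // !inE negb_or u1.
case: (boolP ((a < #|A w|%:R) && (a < #|B w|%:R))) => [/andP[aA aB]|nab]; last first.
  apply: le_trans (_ : P (fun=> false) <= _).
    by apply: (le_Pr q01) => w'; rewrite /E2 AE BE andbA (negPf nab).
  by rewrite /P Ex_cst expR_ge0.
apply: le_trans (_ : P (fun w' => #|overlap (graph_of (merge S w w')) v u|%:R <= t) <= _).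
  by apply: (le_Pr q01) => w'; rewrite /E2 AE BE => /and3P[].
have AU z : z \in A w -> z \in U1 by rewrite inE => /andP[].
have BU z : z \in B w -> z \in U3 by rewrite inE => /andP[].
have n12 z x : z \in U1 -> x \in U2 -> z != x.
  by move=> zU xU; apply: contraTneq zU => ->; rewrite (disjointFl d12 xU).
have n32 z x : z \in U3 -> x \in U2 -> z != x.
  by move=> zU xU; apply: contraTneq zU => ->; rewrite (disjointFl d32 xU).
have n13 z x : z \in U1 -> x \in U3 -> z != x.
  by move=> zU xU; apply: contraTneq zU => ->; rewrite (disjointFl d13 xU).
pose Sx x (C : {set T}) := [set slot x z | z in C]%SET.
have dep x (C : {set T}) : depends_on (Sx x C) (fun w' => [exists z in C, slot x z \in w']).
  move=> w1 w2 e; apply: eq_existsb => z; case zC: (z \in C) => //=.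
  by apply: e; apply: imset_f.
have depS x (C C' : {set T}) : C \subset C' ->
    depends_on (Sx x C') (fun w' => [exists z in C, slot x z \in w']).
  by move=> CC; apply: depends_onS (dep x C); apply: imsetS.
apply: (count_lower q01 (P := mem U2) (S := fun x => Sx x (A w :|: B w))
  (X := fun x w' => [exists z in A w, slot x z \in w'] &&
                    [exists z in B w, slot x z \in w'])).
- move=> x y xU yU xy; apply/pred0P => e; apply/negP => /= /andP[].
  case/imsetP => z zAB -> /imsetP[z' z'AB]; apply/eqP; apply: slot_neq => //.
  case/finset.setUP: z'AB => [/AU z1|/BU z3]; rewrite eq_sym; first exact: n12.
  exact: n32.
- move=> x xU w1 w2 e; congr andb.
    by apply: (depS x (A w)) e; apply: finset.subsetUl.
  by apply: (depS x (B w)) e; apply: finset.subsetUr.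
- apply: (@le_trans _ _ (\sum_(x in U2) ((a * p / 4) * (a * p / 4)))).
    by rewrite sumr_const_pred ler_wpM2r ?ler_nat // mulr_ge0.
  apply: ler_sum => x xU.
  rewrite (Pr_and_indep (S := Sx x (A w)) (S' := Sx x (B w))) //.
    apply: ler_pM => //; apply: exists_nbr_lower => //.
    + by apply/negP => /AU x1; have := n12 _ _ x1 xU; rewrite eqxx.
    + by rewrite a0 ltW.
    + by apply/negP => /BU x1; have := n32 _ _ x1 xU; rewrite eqxx.
    + by rewrite a0 ltW.
  apply/pred0P => e; apply/negP => /= /andP[].
  case/imsetP => z /AU zA -> /imsetP[z' /BU z'B] /eqP; rewrite slot_inj => /eqP zz.
  by have := n13 _ _ zA z'B; rewrite zz eqxx.
- move=> w'; apply: subset_leq_card; apply/fintype.subsetP => x.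
  rewrite inE => /and3P[xU /exists_inP[z zA zx] /exists_inP[z' z'B z'x]].
  have inS y : y \in U1 :|: U3 -> slot x y \in S.
    move=> yU; apply/imsetP; exists (y, x); last by rewrite /= slotC.
    by rewrite in_setX yU.
  have adjx y : y \in U1 :|: U3 -> slot x y \in w' -> adj (graph_of (merge S w w')) y x.
    move=> yU yw; rewrite adj_graph_of in_merge -/(slot y x) slotC inS // yw andbT.
    by case/finset.setUP: yU => yU; [exact: n12|exact: n32].
  have zz : adj (graph_of (merge S w w')) v z.
    by move: zA; rewrite -(AE w') inE in_nbrs => /andP[].
  have zz' : adj (graph_of (merge S w w')) u z'.
    by move: z'B; rewrite -(BE w') inE in_nbrs => /andP[].
  rewrite inE; apply/andP; split.
    by apply: gball2_nbr2 zz _; apply: adjx => //; rewrite inE AU.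
  apply/existsP; exists z'; rewrite zz' /=.
  by apply: adjx => //; rewrite inE BU ?orbT.
Qed.

End Tails.

(** * Anticoncentration of the binomial law *)

Section BinomialAnticoncentration.

(** The central binomial coefficient is of order [4^j / sqrt j]; squaring avoids
    the root. *)
Lemma central_bin_le j : ('C(j.*2, j) ^ 2 * j.*2.+1 <= 16 ^ j)%N.
Proof.
elim: j => [|j IH]; first by [].
have h1 : (j.+1 * 'C(j.+1.*2, j.+1) = 2 * (j.*2.+1 * 'C(j.*2, j)))%N.
  have a1 : (j.+1 * 'C(j.+1.*2, j.+1) = j.+1.*2 * 'C(j.*2.+1, j))%N.
    by rewrite -mul_bin_diag doubleS.
  have a2 : (j.*2.+1 * 'C(j.*2, j) = j.+1 * 'C(j.*2.+1, j.+1))%N.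
    by rewrite -mul_bin_diag.
  have a3 : 'C(j.*2.+1, j.+1) = 'C(j.*2.+1, j).
    by rewrite -[RHS]bin_sub; [congr ('C(_, _)); lia | lia].
  rewrite a1 a2 a3; lia.
set A := 'C(j.+1.*2, j.+1) in h1 *; set B := 'C(j.*2, j) in h1 IH.
have step : ((j.+1 * A) ^ 2 * j.+1.*2.+1 <= j.+1 ^ 2 * 16 ^ j.+1)%N.
  rewrite h1 [(16 ^ j.+1)%N]expnS; set D := (16 ^ j)%N in IH *.
  have e : ((2 * (j.*2.+1 * B)) ^ 2 * j.+1.*2.+1 =
            (B ^ 2 * j.*2.+1) * (4 * (j.*2.+1 * j.+1.*2.+1)))%N.
    by rewrite !expnMn; ring.
  rewrite e; apply: (@leq_trans (D * (4 * (j.*2.+1 * j.+1.*2.+1)))%N).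
    by rewrite leq_mul2r IH orbT.
  have h : (4 * (j.*2.+1 * j.+1.*2.+1) <= 16 * j.+1 ^ 2)%N by rewrite -!mul2n; nia.
  apply: leq_trans (leq_mul (leqnn D) h) _.
  by rewrite leq_eqVlt; apply/orP; left; apply/eqP; ring.
by move: step; rewrite expnMn -mulnA leq_pmul2l // expn_gt0.
Qed.

(** The square is one of the terms of Vandermonde's sum. *)
Lemma bin_sqr_le j k : ('C(j, k) ^ 2 <= 'C(j.*2, j))%N.
Proof.
case: (leqP k j) => kj; last by rewrite bin_small.
rewrite -addnn -binomial.Vandermonde.
have kj' : (k < j.+1)%N by [].
rewrite (bigD1 (Ordinal kj')) //= bin_sub // mulnn.
exact: leq_addr.
Qed.

Lemma bin_pow4_le j k : ('C(j, k) ^ 4 * j.*2.+1 <= 16 ^ j)%N.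
Proof.
apply: leq_trans (central_bin_le j); rewrite leq_mul2r; apply/orP; right.
by rewrite (expnM _ 2 2) leq_exp2r // bin_sqr_le.
Qed.

Context {R : realType}.

Lemma bin_le_exp2 (l j k : nat) (d : R) : 0 <= d ->
  1 <= d ^+ 4 * l.*2.+1%:R -> (l <= j)%N -> 'C(j, k)%:R <= d * 2 ^+ j.
Proof.
move=> d0 dl lj.
rewrite -(@ler_pXn2r _ 4) // ?nnegrE ?mulr_ge0 ?exprn_ge0 //.
have := bin_pow4_le j k; rewrite -(ler_nat R) natrM !natrX => h.
have e : 2 ^+ j ^+ 4 = 16 ^+ j :> R.
  by rewrite -exprM mulnC exprM; congr (_ ^+ _); ring.
have d40 : 0 <= d ^+ 4 by apply: exprn_ge0.
have dj : 1 <= d ^+ 4 * j.*2.+1%:R.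
  by apply: le_trans dl _; rewrite ler_wpM2l // ler_nat ltnS leq_double.
rewrite exprMn e; apply: le_trans (ler_wpM2l d40 h).
rewrite mulrCA -[leLHS]mulr1 ler_wpM2l // exprn_ge0 //.
Qed.

Lemma coef_binomial (c d : R) n k :
  ((c%:P + d *: 'X) ^+ n)`_k = 'C(n, k)%:R * c ^+ (n - k) * d ^+ k.
Proof.
rewrite exprDn coef_sum.
under eq_bigr => i _.
  rewrite coefMn -polyC_exp coefCM exprZn coefZ coefXn; over.
case: (leqP k n) => kn; last first.
  rewrite bin_small // !mul0r big1 // => i _.
  by rewrite (_ : (k == i) = false) ?mulr0 ?mul0rn //; apply/eqP; have := ltn_ord i; lia.
have kn' : (k < n.+1)%N by [].
rewrite (bigD1 (Ordinal kn')) //= eqxx big1 ?addr0.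
  by rewrite -[LHS]mulr_natl mulr1 mulrA.
move=> i; rewrite -val_eqE /= eq_sym => /negPf ->; by rewrite mulr0 mulr0 mul0rn.
Qed.

(** Keeping each of [j] points with probability 1/2, when [j] is binomial with
    parameters [n] and [2 p], gives the binomial law with parameters [n] and
    [p]: this is the case [u = 1 - 2 p], [v = p]. *)
Lemma binomial_thinning (u v : R) n k :
  \sum_(j < n.+1) 'C(n, j)%:R * u ^+ (n - j) * v ^+ j * 'C(j, k)%:R =
  'C(n, k)%:R * (u + v) ^+ (n - k) * v ^+ k.
Proof.
rewrite -coef_binomial.
have -> : (u + v)%:P + v *: 'X = u%:P + v *: (1%:P + 1 *: 'X) :> {poly R}.
  by rewrite polyCD scalerDr scale1r addrA polyC1 alg_polyC.
rewrite exprDn coef_sum; apply: eq_bigr => j _.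
rewrite coefMn -polyC_exp coefCM exprZn coefZ coef_binomial !expr1n !mulr1.
by rewrite -mulr_natl; ring.
Qed.

(** By thinning, a binomial of parameter [p] is a fair binomial of random length
    [j].  A fair binomial of length [j >= l] takes each value with probability
    at most [d], of order [l^(-1/4)]; and [j < l] is unlikely, since the bound
    [2^l] on [2^j] turns the sum over all [j] into [(1 - p)^n]. *)
Lemma binomial_pmf_le (p d : R) n l k : 0 <= p <= 2^-1 -> 0 <= d ->
  1 <= d ^+ 4 * l.*2.+1%:R ->
  'C(n, k)%:R * (1 - p) ^+ (n - k) * p ^+ k <= 2 ^+ l * (1 - p) ^+ n + d.
Proof.
move=> /andP[p0 p2] d0 dl.
have u0 : 0 <= 1 - 2 * p by lra.
(* tm j is the probability of j under the binomial law of parameter 2 p, divided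
   by 2 ^ j *)
pose tm j : R := 'C(n, j)%:R * (1 - 2 * p) ^+ (n - j) * p ^+ j.
have tm0 j : 0 <= tm j by rewrite !mulr_ge0 ?exprn_ge0.
have -> : 1 - p = (1 - 2 * p) + p by ring.
rewrite -binomial_thinning.
apply: (@le_trans _ _ (\sum_(j < n.+1) (2 ^+ l * tm j + d * (2 ^+ j * tm j)))).
  apply: ler_sum => j _; rewrite -/(tm j).
  case: (leqP l j) => lj.
    rewrite mulrC mulrA -[leLHS]add0r lerD ?mulr_ge0 ?exprn_ge0 //.
    by rewrite ler_wpM2r // (bin_le_exp2 k d0 dl lj).
  rewrite -[leLHS]addr0 mulrC lerD ?mulr_ge0 ?exprn_ge0 //.
  rewrite ler_wpM2r // -natrX ler_nat.
  apply: (@leq_trans (2 ^ j)%N); last by rewrite leq_exp2l // ltnW.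
  rewrite -[(2 ^ j)%N]/((1 + 1) ^ j)%N expnDn.
  case: (leqP k j) => kj; last by rewrite bin_small.
  have kj' : (k < j.+1)%N by [].
  by rewrite (bigD1 (Ordinal kj')) //= !exp1n !muln1 leq_addr.
rewrite big_split /= -!mulr_sumr; apply: lerD.
  rewrite ler_wpM2l ?exprn_ge0 // exprDn le_eqVlt; apply/orP; left; apply/eqP.
  by apply: eq_bigr => j _; rewrite -mulr_natl mulrA.
have -> : \sum_(j < n.+1) 2 ^+ j * tm j = 1; last by rewrite mulr1.
transitivity (((1 - 2 * p) + 2 * p) ^+ n); last by rewrite subrK expr1n.
rewrite exprDn; apply: eq_bigr => j _; rewrite -[RHS]mulr_natl exprMn /tm; ring.
Qed.

End BinomialAnticoncentration.

Section PointProbability.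
Context {R : realType} {E : finType} (q : E -> R) (I : finType).

(** Summing over the set [J] of events that occur. *)
Lemma Pr_hits_eq (P : pred I) (S : I -> {set E}) (X : I -> pred {set E})
    (p : R) (k : nat) :
  (forall i j, P i -> P j -> i != j -> [disjoint S i & S j]) ->
  (forall i, P i -> depends_on (S i) (X i)) ->
  (forall i, P i -> Pr q (X i) = p) ->
  Pr q (fun w => #|[pred i | P i && X i w]| == k) =
  'C(#|P|, k)%:R * (1 - p) ^+ (#|P| - k) * p ^+ k.
Proof.
move=> dis dX Xp.
pose B := [set i | P i].
have cB : #|B| = #|P| by rewrite cardsE.
pose Q := [pred J : {set I} | (J \subset B) && (#|J| == k)].
transitivity (Ex q (fun w => \sum_(J | Q J) \prod_(i | P i) ((X i w == (i \in J))%:R : R))).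
  apply: eq_Ex => w.
  pose J0 := [set i | P i && X i w].
  have J0B : J0 \subset B by apply/fintype.subsetP => i; rewrite !inE => /andP[].
  have cJ0 : #|J0| = #|[pred i | P i && X i w]| by rewrite cardsE.
  rewrite -cJ0.
  have z (J : {set I}) : J \subset B -> J != J0 -> \prod_(i | P i) ((X i w == (i \in J))%:R : R) = 0.
    move=> JB JJ0; apply/eqP/prodf_eq0; apply: contrapT => no.
    move/eqP: JJ0; apply.
    apply/setP => i; rewrite !inE.
    case Pi: (P i) => /=; last first.
      by apply/negP => /(fintype.subsetP JB); rewrite inE Pi.
    apply/eqP; rewrite eq_sym -[_ == _]negbK; apply/negP => ne; apply: no; exists i => //.
    by rewrite (negPf ne).
  case: eqP => [e|ne].
    rewrite (bigD1 J0) /=; last by rewrite J0B e eqxx.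
    rewrite [X in _ + X]big1 ?addr0; last by move=> J /andP[/andP[JB _] JJ0]; apply: z.
    by apply/esym; apply: big1 => i Pi; rewrite inE Pi /= eqxx.
  apply/esym; apply: big1 => J /andP[JB /eqP cJ]; apply: z => //.
  by apply: contra_notN ne => /eqP <-.
rewrite Ex_sum.
transitivity (\sum_(J | Q J) ((1 - p) ^+ (#|P| - k) * p ^+ k)).
  apply: eq_bigr => J /andP[JB /eqP cJ].
  rewrite (Ex_prod_indep q dis); last by move=> i Pi w w' /(dX _ Pi) ->.
  rewrite (bigID (mem J)) /= mulrC.
  have JP i : i \in J -> P i by move=> /(fintype.subsetP JB); rewrite inE.
  congr (_ * _).
    rewrite (eq_bigr (fun=> 1 - p)); last first.
      move=> i /andP[Pi iJ]; rewrite -(Xp i Pi) -(Pr_predC _ (X i)).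
      by apply: eq_Ex => w; rewrite (negPf iJ); case: (X i w).
    rewrite prodr_const; congr (_ ^+ _).
    rewrite -cB -cJ -cardsDS //; apply: eq_card => i.
    by rewrite !inE andbC.
  rewrite (eq_bigr (fun=> p)); last first.
    move=> i /andP[Pi iJ]; rewrite -(Xp i Pi).
    by apply: eq_Ex => w; rewrite iJ; case: (X i w).
  rewrite prodr_const -cJ; congr (_ ^+ _).
  apply: eq_card => i; rewrite -[LHS]/(P i && (i \in J)).
  by case iJ: (i \in J); rewrite ?andbF // JP.
rewrite sumr_const_pred -mulrA; congr (_%:R * _).
by rewrite -cB -cards_draws cardsE; apply: eq_card => J; rewrite !inE.
Qed.

End PointProbability.

(** * The dense regime at fixed size *)

Section DenseTails.
Context {R : realType} {T : finType} (p : R).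
Context (p01 : 0 <= p <= 2^-1).
Notation P := (Pr (@slot_prob R T p)).
Let p01' : 0 <= p <= 1. Proof. by case/andP: p01 => *; apply/andP; split; lra. Qed.
Let q01 := @slot_prob01 R T p p01'.
Implicit Types (w : {set {set T}}) (x y z u v : T).

Lemma card_neq2 x y : x != y -> #|[pred z | (z != x) && (z != y)]| = (#|T| - 2)%N.
Proof.
move=> xy; rewrite -(cardC (mem [set x; y]%SET)) cards2 xy addKn.
by apply: eq_card => z; rewrite !inE negb_or.
Qed.

(** Fix everything but the slots between [y] and the vertices other than [x]:
    the degree of [x] is then known, and that of [y] must take a prescribed
    value. *)
Lemma deg_eq_le x y l (d : R) : x != y -> 0 <= d -> 1 <= d ^+ 4 * l.*2.+1%:R ->
  P (fun w => #|nbrs (graph_of w) x| == #|nbrs (graph_of w) y|) <=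
  2 ^+ l * (1 - p) ^+ (#|T| - 2) + d.
Proof.
move=> xy d0 dl.
pose Q := [pred z | (z != x) && (z != y)].
pose S := [set slot y z | z in Q]%SET.
apply: (Pr_resample_le q01 (S := S)) => w.
pose N w' := #|[pred z | Q z && (slot y z \in w')]|.
have slS z : slot x z \notin S.
  apply/negP => /imsetP[z' /andP[z'x _]]; apply/eqP; apply: slot_neq => //.
  by rewrite eq_sym.
have sameX w' : nbrs (graph_of (merge S w w')) x = nbrs (graph_of w) x.
  apply/setP => z; rewrite !in_nbrs !adj_graph_of in_merge -/(slot x z).
  by rewrite (negPf (slS z)).
have degY w' : #|nbrs (graph_of (merge S w w')) y| = ((slot x y \in w) + N w')%N.
  rewrite (cardsD1 x) in_nbrs adj_graph_of in_merge -/(slot y x) slotC.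
  rewrite eq_sym xy (negPf (slS y)) /=; congr addn.
  apply: eq_card => z; rewrite !inE adj_graph_of in_merge -/(slot y z) eq_sym [y == z]eq_sym.
  case zx: (x == z) => //=; case zy: (z == y) => //=.
  by rewrite (_ : slot y z \in S) //; apply: imset_f; rewrite inE eq_sym zx zy.
pose k0 := (#|nbrs (graph_of w) x| - (slot x y \in w))%N.
apply: le_trans (_ : P (fun w' => N w' == k0) <= _).
  apply: (le_Pr q01) => w'; rewrite sameX degY => /eqP e.
  by rewrite /k0 e addKn.
rewrite (Pr_hits_eq (P := Q) (S := fun z => [set slot y z]) (p := p)).
- by rewrite card_neq2 //; apply: binomial_pmf_le.
- by move=> i j _ _ ij; rewrite disjoints1 inE slot_inj.
- by move=> i _; apply: depends_on_slot.
- by move=> i /andP[_ iy]; rewrite Pr_slot_in // eq_sym.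
Qed.

(** A class of [M] vertices accounts for [M (M - 1)] ordered pairs of distinct
    vertices of equal degree, whose expected number is at most
    [#|T|^2 eta]. *)
Lemma deg_class_upper M (eta : R) : (1 < M)%N -> 0 <= eta ->
  (forall x y, x != y ->
     P (fun w => #|nbrs (graph_of w) x| == #|nbrs (graph_of w) y|) <= eta) ->
  P (fun w => [exists k : 'I_#|T|.+1, (M <= #|deg_class (graph_of w) k|)%N]) <=
  (#|T| * #|T|)%:R * eta / (M * M.-1)%:R.
Proof.
move=> M1 eta0 heta.
pose F w : R := \sum_x \sum_(y | x != y)
  (#|nbrs (graph_of w) x| == #|nbrs (graph_of w) y|)%:R.
have M0 : (0 : R) < (M * M.-1)%:R by rewrite ltr0n muln_gt0; lia.
apply: le_trans (Markov q01 (F := F) (c := (M * M.-1)%:R) _ M0 _) _.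
- by move=> w; apply: sumr_ge0 => x _; apply: sumr_ge0.
- move=> w /existsP[k kM]; rewrite /F.
  set C := deg_class (graph_of w) k in kM.
  rewrite (bigID (mem C)) /=.
  apply: (@le_trans _ _ (\sum_(x in C) (#|C|.-1%:R : R))).
    rewrite sumr_const_pred -natrM ler_nat.
    have MC : (M.-1 <= #|C|.-1)%N by lia.
    exact: leq_mul.
  rewrite -[leLHS]addr0 lerD //; last by apply: sumr_ge0 => x _; apply: sumr_ge0.
  apply: ler_sum => x xC; rewrite (bigID (mem C)) /=.
  apply: (@le_trans _ _ (\sum_(y | (x != y) && (y \in C)) (1 : R))).
    rewrite sumr_const ler_nat (cardsD1 x C) xC /=.
    apply: eq_leq; rewrite add0n; apply: eq_card => y.
    by rewrite in_setD1 -[RHS]/((x != y) && (y \in C)) eq_sym.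
  rewrite -[leLHS]addr0 lerD //; last exact: sumr_ge0.
  apply: ler_sum => y /andP[_ yC]; move: xC yC; rewrite !inE => /eqP-> /eqP->.
  by rewrite eqxx.
- rewrite ler_wpM2r ?invr_ge0 // /F Ex_sum.
  apply: (@le_trans _ _ (\sum_(x : T) \sum_(y : T) eta)).
    apply: ler_sum => x _; rewrite Ex_sum.
    rewrite [leRHS](bigID (fun y => x != y)) /= -[leLHS]addr0 lerD //.
      by apply: ler_sum => y xy; apply: heta.
    exact: sumr_ge0.
  by rewrite !sumr_const natrM -mulrA !mulr_natl.
Qed.

(** The left-hand side is the probability that a sum of [2 t] independent
    Bernoulli variables of parameter [p] is even. *)
Lemma even_prob_le t Q : 1 + 4 * p * t%:R <= Q ->
  (1 + ((1 - 2 * p) * (1 - 2 * p)) ^+ t) / 2 <= expR (- (2 * p * t%:R / Q)) :> R.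
Proof.
have /andP[p0 p2] := p01 => hQ.
have t0 : 0 <= t%:R :> R by [].
set y := 4 * p * t%:R in hQ.
have y0 : 0 <= y by rewrite !mulr_ge0.
have Q0 : 0 < Q by lra.
have h1 : ((1 - 2 * p) * (1 - 2 * p)) ^+ t <= (1 + y)^-1.
  apply: (@le_trans _ _ (expR (- y))); last first.
    by rewrite expRN lef_pV2 ?posrE ?expR_gt0 ?expR_ge1Dx //; lra.
  have -> : - y = t%:R * (- (4 * p)) by rewrite /y; ring.
  rewrite expRM_natl lerXn2r ?nnegrE ?expR_ge0 //; first by rewrite mulr_ge0 //; lra.
  have -> : - (4 * p) = - (2 * p) + - (2 * p) by ring.
  have := expR_ge1Dx (- (2 * p)); rewrite expRD => h.
  by apply: ler_pM => //; lra.
have h2 : (1 + (1 + y)^-1) / 2 <= 1 - y / (2 * Q).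
  have e : (1 + (1 + y)^-1) / 2 = 1 - y / (2 * (1 + y)) by field; lra.
  rewrite e lerD2l lerN2 ler_wpM2l // lef_pV2 ?posrE; lra.
have e : 2 * p * t%:R / Q = y / (2 * Q) by rewrite /y; field; lra.
rewrite e; apply: le_trans (expR_ge1Dx _).
by apply: le_trans h2; lra.
Qed.

Lemma Ex_sign_slot x y : x != y ->
  Ex (@slot_prob R T p) (fun w => 1 - 2 * (slot x y \in w)%:R) = 1 - 2 * p.
Proof.
move=> xy; transitivity (Ex (@slot_prob R T p) (fun=> 1) +
    - 2 * P (fun w => slot x y \in w)).
  by rewrite -ExZ -ExD; apply: eq_Ex => w; ring.
by rewrite Ex_cst Pr_slot_in //; ring.
Qed.

(** Fix the edges avoiding [x] and [x'] and let the others vary.  The classes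
    [off_class] are then fixed and, unless some degree class is large, have at
    most [3 M] vertices.  If the invariants agree, [x] and [x'] have equally
    many neighbours in each class, so the total of both numbers is even.  The
    sign [h] of each vertex makes the indicator of this event the product [F],
    whose factors are independent as the classes are disjoint. *)
Lemma nbr_degs_eq_le x x' M Q : x != x' -> 1 + 12 * p * M%:R <= Q ->
  P (fun w => [forall k : 'I_#|T|.+1,
        nbr_degs (graph_of w) x k == nbr_degs (graph_of w) x' k] &&
      ~~ [exists k : 'I_#|T|.+1, (M <= #|deg_class (graph_of w) k|)%N]) <=
  expR (- (2 * p * (#|T| - 2)%:R / Q)).
Proof.
move=> xx' hQ; have /andP[p0 p2] := p01.
pose U := ~: [set x; x']%SET.
pose S := [set e : {set T} | (x \in e) || (x' \in e)]%SET.
apply: (Pr_resample_le q01 (S := S)) => w.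
pose C (k : nat) := off_class (graph_of w) x x' k.
have Uneq y : y \in U -> (x != y) /\ (x' != y).
  by rewrite !inE negb_or => /andP[? ?]; rewrite ![_ == y]eq_sym.
have sameD w' y : y \in U ->
    deg_off (graph_of (merge S w w')) x x' y = deg_off (graph_of w) x x' y.
  move=> /Uneq[xy x'y]; apply: eq_card => z; rewrite !finset.in_setD !in_nbrs !adj_graph_of.
  rewrite in_merge -/(slot y z) !inE ![_ == z]eq_sym.
  case: (eqVneq z x) => //= zx; case: (eqVneq z x') => //= zx'.
  by rewrite (negPf xy) (negPf x'y).
have sameC w' k : off_class (graph_of (merge S w w')) x x' k = C k.
  apply/setP => y; rewrite !in_off_class -/U.
  by case yU: (y \in U) => //=; rewrite sameD.
have CU k y : y \in C k -> y \in U by rewrite !inE => /andP[].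
(* minus one to the number of neighbours of y among x and x' *)
pose h y w' : R := (1 - 2 * (slot x y \in w')%:R) * (1 - 2 * (slot x' y \in w')%:R).
case: (boolP [forall k : 'I_#|T|.+1, (#|C k| <= 3 * M)%N]) => [/forallP CM|big]; last first.
  apply: le_trans (_ : P (fun=> false) <= _); last by rewrite /Pr Ex_cst expR_ge0.
  apply: (le_Pr q01) => w' /andP[_ /existsPn small].
  apply: contraNT big => _; apply/forallP => k.
  rewrite -(sameC w'); apply: off_class_le => // j.
  case: (ltnP j #|T|.+1) => jT; first by have := small (Ordinal jT); rewrite -ltnNge.
  rewrite (_ : #|_| = 0%N); last first.
    apply: eq_card0 => y; rewrite inE; apply/eqP => e.
    by have := max_card (mem (nbrs (graph_of (merge S w w')) y)); rewrite e; lia.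
  by have := small ord0; rewrite -ltnNge; case: (M).
have adjx w' y : y \in U -> adj (graph_of (merge S w w')) x y = (slot x y \in w').
  by move=> /Uneq[xy _]; rewrite adj_graph_of xy in_merge !inE eqxx.
have adjx' w' y : y \in U -> adj (graph_of (merge S w w')) x' y = (slot x' y \in w').
  by move=> /Uneq[_ xy]; rewrite adj_graph_of xy in_merge !inE eqxx orbT.
pose F w' : R := \prod_(k < #|T|.+1) ((1 + \prod_(y in C k) h y w') / 2).
have hE w' k : \prod_(y in C k) h y w' =
    (-1) ^+ #|nbrs (graph_of (merge S w w')) x :&: C k| *
    (-1) ^+ #|nbrs (graph_of (merge S w w')) x' :&: C k|.
  rewrite big_split /= -2!prodr_const.
  rewrite ![\prod_(y in C k) _]big_mkcond ![\prod_(y in _ :&: _) _]big_mkcond.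
  congr (_ * _); apply: eq_bigr => y _; rewrite finset.in_setI in_nbrs;
    case yC: (y \in C k); rewrite ?andbF // andbT.
    by rewrite (adjx _ _ (CU _ _ yC)); case: (slot x y \in w') => /=; ring.
  by rewrite (adjx' _ _ (CU _ _ yC)); case: (slot x' y \in w') => /=; ring.
apply: (@le_trans _ _ (Ex (@slot_prob R T p) F)).
  apply: (le_Ex q01) => w'.
  case: (boolP (_ && _)) => [/andP[/forallP eqh _]|_]; last first.
    apply: prodr_ge0 => k _; rewrite hE -exprD.
    by rewrite -signr_odd; case: (odd _); rewrite ?expr1 ?expr0; lra.
  rewrite /F big1 // => k _; rewrite hE.
  have := @card_nbrs_off_class_eq _ (graph_of (merge S w w')) x x' k xx'.
  rewrite sameC => ->; first by rewrite -exprD addnn -signr_odd odd_double expr0; lra.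
  move=> j; case: (ltnP j #|T|.+1) => jT; first exact/eqP/(eqh (Ordinal jT)).
  have z a : nbr_degs (graph_of (merge S w w')) a j = 0%N.
    apply: eq_card0 => y; rewrite inE; apply/negP => /andP[_ /eqP e].
    by have := max_card (mem (nbrs (graph_of (merge S w w')) y)); rewrite e; lia.
  by rewrite !z.
pose Sk (k : 'I_#|T|.+1) := (\bigcup_(y in C k) [set slot x y; slot x' y])%SET.
have CkE k y : y \in C k -> k = deg_off (graph_of w) x x' y.
  by rewrite !inE => /andP[_ /eqP].
have hdep y : depends_on [set slot x y; slot x' y]%SET (h y).
  by move=> w1 w2 e; rewrite /h !e // !inE eqxx ?orbT.
have hdis y z : y \in U -> z \in U -> y != z ->
    [disjoint [set slot x y; slot x' y] & [set slot x z; slot x' z]]%SET.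
  move=> /Uneq[xy x'y] /Uneq[xz x'z] yz.
  by apply: disjoint_slot2 => //; rewrite eq_sym.
have Exh y : y \in U -> Ex (@slot_prob R T p) (h y) = (1 - 2 * p) * (1 - 2 * p).
  move=> /Uneq[xy x'y].
  rewrite (ExM_indep _ (S := [set slot x y]) (S' := [set slot x' y])).
  - by rewrite !Ex_sign_slot.
  - by rewrite disjoints1 inE; apply: slot2_neq => //; rewrite eq_sym.
  - by move=> w1 w2 /(depends_on_slot) ->.
  - by move=> w1 w2 /(depends_on_slot) ->.
rewrite (Ex_prod_indep _ (S := Sk)); first 1 last.
- move=> i j _ _ ij; apply/pred0P => e; apply/negP => /= /andP[].
  case/finset.bigcupP => y yC ey /finset.bigcupP[z zC ez].
  have yz : y != z.
    apply: contraNneq ij => yz; apply/eqP/val_inj; rewrite /= (CkE _ _ yC) (CkE _ _ zC).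
    by rewrite yz.
  by rewrite (disjointFr (hdis _ _ (CU _ _ yC) (CU _ _ zC) yz) ey) in ez.
- move=> k _ w1 w2 e; congr ((1 + _) / 2); apply: eq_bigr => y yC.
  apply: hdep => s sy; apply: e; apply/finset.bigcupP.
  by exists y.
have -> : expR (- (2 * p * (#|T| - 2)%:R / Q)) =
    \prod_(k < #|T|.+1) expR (- (2 * p * #|C k|%:R / Q)) :> R.
  rewrite -expR_sum; congr expR.
  rewrite -(card_neq2 xx') -(_ : #|U| = #|[pred z | (z != x) && (z != x')]|); last first.
    by apply: eq_card => z; rewrite !inE negb_or.
  rewrite -(@card_fibers _ U (deg_off (graph_of w) x x') #|T|); last first.
    by move=> y _; apply: max_card.
  rewrite natr_sum mulr_sumr mulr_suml -sumrN; apply: eq_bigr => k _.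
  by congr (- (_ * _ / _)).
apply: ler_prod => k _; apply/andP; split.
  apply: (Ex_ge0 q01) => w'; rewrite hE -exprD.
  by rewrite -signr_odd; case: (odd _); rewrite ?expr1 ?expr0; lra.
have -> : Ex (@slot_prob R T p) (fun w' => (1 + \prod_(y in C k) h y w') / 2) =
    (1 + ((1 - 2 * p) * (1 - 2 * p)) ^+ #|C k|) / 2.
  transitivity (2^-1 * (1 + Ex (@slot_prob R T p) (fun w' => \prod_(y in C k) h y w'))).
    rewrite -[X in X + _](Ex_cst (@slot_prob R T p)) -ExD -ExZ.
    by apply: eq_Ex => w'; rewrite mulrC.
  rewrite mulrC; congr ((1 + _) / 2).
  rewrite (Ex_prod_indep _ (S := fun y => [set slot x y; slot x' y]%SET)).
  - rewrite -prodr_const; apply: eq_bigr => y yC; apply: Exh; exact: CU yC.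
  - by move=> y z yC zC; apply: hdis; [exact: CU yC|exact: CU zC].
  - by move=> y _; apply: hdep.
apply: even_prob_le; apply: le_trans hQ; rewrite lerD2l.
have : #|C k|%:R <= 3 * M%:R :> R by rewrite -natrM ler_nat CM.
move=> h0; have -> : 12 * p * M%:R = 4 * p * (3 * M%:R) by ring.
by rewrite ler_wpM2l // mulr_ge0.
Qed.

End DenseTails.

(** The error terms account respectively for a pair without a common neighbour, a large
    degree class, and a pair with equal invariants in the absence of large
    classes. *)
Lemma separated_dense (R : realType) (n : nat) (p : R) (l M : nat) (d Q : R) :
  0 <= p <= 2^-1 -> 0 <= d -> 1 <= d ^+ 4 * l.*2.+1%:R -> (1 < M)%N ->
  1 + 12 * p * M%:R <= Q -> (2 <= n)%N ->
  1 - ((n * n)%:R * expR (- ((n%:R - 2) * (p * p) / 2))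
     + (n * n)%:R * (2 ^+ l * (1 - p) ^+ (n - 2) + d) / (M * M.-1)%:R
     + (n * n)%:R * expR (- (2 * p * (n - 2)%:R / Q)))
  <= Gnp_prob p (fun G : sgraph 'I_n => separated G).
Proof.
move=> pp d0 dl M1 hQ n2; have /andP[p0 p2] := pp.
have p01 : 0 <= p <= 1 by rewrite p0; lra.
have q01 := @slot_prob01 R 'I_n p p01.
rewrite Gnp_probE.
pose P := Pr (@slot_prob R 'I_n p).
pose bad1 w := [exists xy : 'I_n * 'I_n, (xy.1 != xy.2) &&
  (#|conbrs (graph_of w) xy.1 xy.2| == 0)%N].
pose bad2 w := [exists k : 'I_#|'I_n|.+1, (M <= #|deg_class (@graph_of 'I_n w) k|)%N].
pose eqd w x y := [forall k : 'I_#|'I_n|.+1,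
  nbr_degs (@graph_of 'I_n w) x k == nbr_degs (graph_of w) y k].
pose bad3 w := [exists xy : 'I_n * 'I_n, (xy.1 != xy.2) &&
  (eqd w xy.1 xy.2 && ~~ bad2 w)].
have good w : ~~ (bad1 w || (bad2 w || bad3 w)) -> `[< separated (graph_of w) >].
  case/norP => /existsPn b1 /norP[b2 /existsPn b3].
  apply/asboolP; split=> x y.
    move=> xy; have := b1 (x, y); rewrite /= xy /= cards_eq0 => /set0Pn[z].
    by rewrite !inE => /andP[xz yz]; exists z; rewrite xz adj_sym.
  move=> eqh; apply/eqP; have := b3 (x, y); rewrite /= b2 andbT negb_and negbK.
  case/orP => // /negP; case; apply/forallP => k.
  by rewrite eqh.
have := le_Pr q01 good; rewrite (Pr_predC _ (fun w => bad1 w || _)).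
apply: le_trans; rewrite lerD2l lerN2.
have cTT : #|{: 'I_n * 'I_n}| = (n * n)%N by rewrite card_prod card_ord.
apply: le_trans (Pr_orB q01 _ _) _; rewrite -!addrA; apply: lerD.
  rewrite -cTT; apply: (Pr_union_card q01); first exact: expR_ge0.
  by move=> [x y] /= xy; have := @conbrs_none R 'I_n p p01 x y xy; rewrite card_ord.
apply: le_trans (Pr_orB q01 _ _) _; apply: lerD.
  have := @deg_class_upper R 'I_n p pp M (2 ^+ l * (1 - p) ^+ (n - 2) + d) M1.
  have -> : (n * n)%:R = (#|'I_n| * #|'I_n|)%:R :> R by rewrite card_ord.
  apply.
    by rewrite addr_ge0 // mulr_ge0 // exprn_ge0 // subr_ge0; case/andP: p01.
  by move=> x y xy; have := @deg_eq_le R 'I_n p pp x y l d xy d0 dl; rewrite card_ord.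
rewrite -cTT; apply: (Pr_union_card q01); first exact: expR_ge0.
move=> [x y] /= xy.
have -> : (n - 2)%N = (#|'I_n| - 2)%N by rewrite card_ord.
exact: (@nbr_degs_eq_le R 'I_n p pp x y M Q xy hQ).
Qed.

(** * The sparse regime at fixed size *)

Section SparseBound.
Context {T : finType}.

Lemma subset_of_card (B : {set T}) m : (m <= #|B|)%N ->
  exists2 U : {set T}, U \subset B & #|U| = m.
Proof.
move=> mB; exists [set x in take m (enum B)]%SET.
  by apply/fintype.subsetP => x; rewrite inE => /mem_take; rewrite mem_enum.
rewrite cardsE; have /card_uniqP -> := take_uniq m (enum_uniq (mem B)).
by rewrite size_take -cardE; case: ltngtP mB.
Qed.

Lemma three_disjoint_sets (B : {set T}) m : (3 * m <= #|B|)%N ->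
  exists U1 U2 U3 : {set T},
    [/\ [/\ U1 \subset B, U2 \subset B & U3 \subset B],
        [/\ [disjoint U1 & U2], [disjoint U3 & U2] & [disjoint U1 & U3]]
      & [/\ #|U1| = m, #|U2| = m & #|U3| = m]].
Proof.
move=> mB.
have [|U1 U1B c1] := @subset_of_card B m; first by lia.
have cB1 : #|B :\: U1| = (#|B| - m)%N by rewrite cardsDS // c1.
have [|U2 U2B c2] := @subset_of_card (B :\: U1) m; first by rewrite cB1; lia.
have cB2 : #|B :\: U1 :\: U2| = (#|B| - m - m)%N by rewrite cardsDS // cB1 c2.
have [|U3 U3B c3] := @subset_of_card (B :\: U1 :\: U2) m; first by rewrite cB2; lia.
move: U2B U3B; rewrite !finset.subsetD => /andP[U2B d21] /andP[/andP[U3B d31] d32].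
by exists U1, U2, U3; rewrite ![[disjoint U1 & _]]disjoint_sym.
Qed.
End SparseBound.

(** The error terms account respectively for a pair of twins, a large codegree, a large
    degree, and a small overlap. *)
Lemma reconstructable_sparse (R : realType) (n : nat) (p : R)
    (h c D m : nat) (a t s : R) :
  0 <= p <= 2^-1 -> 0 <= s -> 0 <= a -> a * p <= 2 -> (3 * m + 2 <= n)%N ->
  (3 * (h + h) + 2 * (c * D))%:R <= t ->
  1 - (n%:R ^+ (4 * h) * expR (- ((h * h)%:R * p / 2))
     + (n * n)%:R * (expR (s * (n%:R * (p * p))) / (1 + s) ^+ c.+1)
     + n%:R * (expR (n%:R * p) / 2 ^+ D.+1)
     + (n * n)%:R * (2 * expR (a - m%:R * p / 2) +
          expR (t - m%:R * ((a * p / 4) * (a * p / 4)) / 2)))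
  <= Gnp_prob p (fun G : sgraph 'I_n => exactly_reconstructable 2 G).
Proof.
move=> /andP[p0 p2] s0 a0 ap2 mn ht.
have p01 : 0 <= p <= 1 by rewrite p0; lra.
have q01 := @slot_prob01 R 'I_n p p01.
rewrite Gnp_probE.
pose P := Pr (@slot_prob R 'I_n p).
pose bad1 w := `[< ~ twin_free (h + h) (@graph_of 'I_n w) >].
pose bad2 w := [exists xy : 'I_n * 'I_n, (xy.1 != xy.2) &&
  (c.+1 <= #|conbrs (graph_of w) xy.1 xy.2|)%N].
pose bad3 w := [exists x : 'I_n, true && (D.+1 <= #|nbrs (graph_of w) x|)%N].
pose bad4 w := [exists xy : 'I_n * 'I_n, (xy.1 != xy.2) &&
  (#|overlap (graph_of w) xy.1 xy.2|%:R <= t)].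
have good w : ~~ (bad1 w || (bad2 w || (bad3 w || bad4 w))) ->
    `[< exactly_reconstructable 2 (graph_of w) >].
  case/norP => b1 /norP[/existsPn b2 /norP[/existsPn b3 /existsPn b4]].
  have tf : twin_free (h + h) (graph_of w) by move/asboolPn: b1 => /contrapT.
  apply/asboolP; apply: (reconstructable_of_overlap (c := c) (D := D) tf).
  - move=> x y xy; have := b2 (x, y); rewrite /= xy /= -ltnNge ltnS.
    exact.
  - by move=> x; have := b3 x; rewrite /= -ltnNge ltnS.
  - move=> v w' vw; have := b4 (v, w'); rewrite /= vw /= -ltNge => ht'.
    by rewrite -(ler_nat R); apply: le_trans ht (ltW ht').
have := le_Pr q01 good; rewrite (Pr_predC _ (fun w => bad1 w || _)).
apply: le_trans; rewrite lerD2l lerN2.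
apply: le_trans (Pr_orB q01 _ _) _; rewrite -!addrA; apply: lerD.
  by have := @twin_free_likely R 'I_n p p01 h p2; rewrite card_ord.
apply: le_trans (Pr_orB q01 _ _) _; apply: lerD.
  have cTT : #|{: 'I_n * 'I_n}| = (n * n)%N by rewrite card_prod card_ord.
  rewrite -cTT; apply: (Pr_union_card q01).
    by rewrite divr_ge0 ?expR_ge0 // exprn_ge0 //; lra.
  by move=> [x y] /= xy; have := @conbrs_upper R 'I_n p p01 x y s c.+1 s0 xy; rewrite card_ord.
apply: le_trans (Pr_orB q01 _ _) _; apply: lerD.
  rewrite -[X in X%:R * (expR _ / _)]card_ord; apply: (Pr_union_card q01).
    by rewrite divr_ge0 ?expR_ge0 // exprn_ge0.
  move=> x _; have := @nbrs_upper R 'I_n p p01 x 1 D.+1 ler01.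
  by rewrite mul1r card_ord.
have cTT : #|{: 'I_n * 'I_n}| = (n * n)%N by rewrite card_prod card_ord.
rewrite -cTT; apply: (Pr_union_card q01).
  by rewrite addr_ge0 ?mulr_ge0 ?expR_ge0.
move=> [x y] /= xy.
have [|U1 [U2 [U3 [[s1 s2 s3] [d12 d32 d13] [c1 c2 c3]]]]] :=
    @three_disjoint_sets _ (~: [set x; y]%SET) m.
  by rewrite cardsCs finset.setCK card_ord cards2 xy; lia.
have UU : U1 :|: U2 :|: U3 \subset ~: [set x; y]%SET by rewrite !finset.subUset s1 s2 s3.
apply: (overlap_lower p01 (U1 := U1) (U2 := U2) (U3 := U3)) => //.
- by apply/negP => /(fintype.subsetP UU); rewrite !inE eqxx.
- by apply/negP => /(fintype.subsetP UU); rewrite !inE eqxx orbT.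
- by rewrite c1.
- by rewrite c2.
- by rewrite c3.
Qed.

Local Open Scope classical_set_scope.

(** * Asymptotics *)

Section Asymptotics.
Context {R : realType}.
Implicit Types (a b c K : R) (n : nat).

Lemma near_powR_ge a K : 0 < a -> \forall n \near \oo, K <= n%:R `^ a.
Proof.
move=> a0; near=> n.
have n0 : (0 : R) <= n%:R by [].
have KK : `|K| `^ a^-1 <= n%:R by near: n; exact: nbhs_infty_ger.
apply: le_trans (ler_norm K) _.
have -> : `|K| = (`|K| `^ a^-1) `^ a.
  by rewrite -powRrM mulVf ?lt0r_neq0 // powRr1.
by apply: (ge0_ler_powR (ltW a0)); rewrite ?nnegrE ?powR_ge0.
Unshelve. all: by end_near. Qed.

Lemma powRD_nat n a b : (0 < n)%N -> n%:R `^ (a + b) = n%:R `^ a * n%:R `^ b :> R.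
Proof. by move=> n0; rewrite powRD // pnatr_eq0 -lt0n n0 implybT. Qed.

Lemma near_powR_le a b K : a < b ->
  \forall n \near \oo, K * n%:R `^ a <= n%:R `^ b :> R.
Proof.
move=> ab; near=> n.
have n0 : (0 < n)%N by near: n; exact: nbhs_infty_gt.
have -> : b = (b - a) + a by rewrite subrK.
rewrite powRD_nat // ler_wpM2r ?powR_ge0 //.
by near: n; apply: near_powR_ge; rewrite subr_gt0.
Unshelve. all: by end_near. Qed.

Lemma near_ln_le a K : 0 < a -> \forall n \near \oo, K * ln n%:R <= n%:R `^ a :> R.
Proof.
move=> a0; near=> n.
have n1 : (0 < n)%N by near: n; exact: nbhs_infty_gt.
have n0 : (0 : R) < n%:R by rewrite ltr0n.
have l0 : 0 <= ln (n%:R : R) by apply: ln_ge0; rewrite ler1n.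
have a2 : 0 < a / 2 by rewrite divr_gt0.
have lnle : ln (n%:R : R) <= (a / 2)^-1 * n%:R `^ (a / 2).
  rewrite -ler_pdivrMl ?invr_gt0 // invrK -ln_powR ltW // ln_sublinear //.
  exact: powR_gt0.
apply: le_trans (_ : `|K| * ln n%:R <= _).
  by rewrite ler_wpM2r // ler_norm.
apply: le_trans (ler_wpM2l (normr_ge0 _) lnle) _.
rewrite mulrA; near: n; apply: near_powR_le.
by lra.
Unshelve. all: by end_near. Qed.

Lemma near_expR_le a c K : 0 < a -> 0 < c ->
  \forall n \near \oo, expR (- (c * n%:R `^ a)) <= n%:R `^ (- K) :> R.
Proof.
move=> a0 c0; near=> n.
have n1 : (0 < n)%N by near: n; exact: nbhs_infty_gt.
have n0 : (0 : R) < n%:R by rewrite ltr0n.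
have -> : n%:R `^ (- K) = expR (- (K * ln n%:R)) :> R.
  by rewrite /powR pnatr_eq0 gtn_eqF // mulNr.
rewrite ler_expR lerN2 -ler_pdivrMl // mulrA.
by near: n; apply: near_ln_le.
Unshelve. all: by end_near. Qed.

Lemma cvg_to_1 (f : nat -> R) a K : 0 < a -> (forall n, f n <= 1) ->
  (\forall n \near \oo, 1 - K * n%:R `^ (- a) <= f n) -> f @ \oo --> (1 : R).
Proof.
move=> a0 f1 fl; apply/cvgrPdist_le => e e0; near=> n.
have n1 : (0 < n)%N by near: n; exact: nbhs_infty_gt.
have na : (0 : R) < n%:R `^ a by apply: powR_gt0; rewrite ltr0n.
have h1 : 1 - K * n%:R `^ (- a) <= f n by near: n.
have h2 : K / e <= n%:R `^ a by near: n; apply: near_powR_ge.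
rewrite ger0_norm ?subr_ge0 // lerBlDr -lerBlDl.
apply: le_trans h1; rewrite lerD2l lerN2 powRN ler_pdivrMr //.
by rewrite mulrC -ler_pdivrMr.
Unshelve. all: by end_near. Qed.

End Asymptotics.

Lemma powRN_prob (R : realType) (n : nat) (a : R) : 0 < a ->
  0 <= (n%:R `^ (- a) : R) <= 1.
Proof.
move=> a0; rewrite powR_ge0 /=; case: n => [|n].
  by rewrite powR0 ?ler01 // oppr_eq0 lt0r_neq0.
have := @ler_powR R n.+1%:R _ (- a) 0; rewrite powRr0; apply; rewrite ?ler1n //.
by rewrite oppr_le0 ltW.
Qed.

Lemma Gnp_prob_le1 (R : realType) (n : nat) (p : R) (E : sgraph 'I_n -> Prop) :
  0 <= p <= 1 -> Gnp_prob p E <= 1.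
Proof. by move=> p01; rewrite Gnp_probE; apply/Pr_le1/slot_prob01. Qed.

Lemma quarter_bounds n : (8 <= n)%N ->
  (n <= (n %/ 4) * 8)%N /\ (3 * (n %/ 4) + 2 <= n)%N.
Proof. by lia. Qed.

Lemma expR_half_le_exp2 (R : realType) (y : R) (k : nat) :
  y <= k%:R -> expR (y / 2) <= 2 ^+ k.
Proof.
move=> yk; have h2 : expR (2^-1) <= 2 :> R.
  have : expR (- 2^-1) >= 2^-1 :> R by have := expR_ge1Dx (- 2^-1 : R); lra.
  by rewrite expRN lef_pV2 ?posrE ?expR_gt0.
apply: (@le_trans _ _ (expR 2^-1 ^+ k)).
  by rewrite -expRM_natl ler_expR ler_wpM2r.
by rewrite lerXn2r ?nnegrE ?expR_ge0.
Qed.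

(** With [s] the inverse of the mean codegree, the exponential factor of the tail
    bound is constant, while the denominator is at least [s ^+ k]. *)
Lemma codegree_term_le (R : realType) (N p s : R) (k : nat) :
  0 < N -> 0 <= s -> s * (N * (p * p)) = 1 -> N * N * N <= s ^+ k ->
  N * N * (expR (s * (N * (p * p))) / (1 + s) ^+ k) <= expR 1 * N^-1.
Proof.
move=> N0 s0 -> hN; rewrite mulrCA ler_wpM2l ?expR_ge0 //.
have sk : s ^+ k <= (1 + s) ^+ k by rewrite lerXn2r ?nnegrE //; lra.
have pos : 0 < (1 + s) ^+ k.
  by apply: lt_le_trans (le_trans hN sk); rewrite !mulr_gt0.
rewrite ler_pdivrMr // ler_pdivlMl //.
by rewrite mulrA; apply: le_trans hN sk.
Qed.

(** Writing [3 - 4 alpha = alpha + 2 eps], twins of [h = n^(alpha + eps)]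
    vertices are excluded because [h p >= n^eps] exceeds [10 ln n], and the
    overlap, of order [n^(3 - 4 alpha)], exceeds [h] and [D = n^(1/2)], the
    latter since [alpha > 1/2].  The codegrees have mean [n^(1 - 2 alpha)], so
    all are below a constant [c] with [(2 alpha - 1) (c + 1) >= 3]. *)
Lemma reconstructable_sparse_whp (R : realType) (alpha : R) :
  1 / 2 < alpha < 3 / 5 ->
  (fun n : nat => Gnp_prob (n%:R `^ (- alpha))
      (fun G : sgraph 'I_n => exactly_reconstructable 2 G)) @ \oo --> (1 : R).
Proof.
move=> /andP[al ar].
pose eps : R := (3 - 5 * alpha) / 2; pose beta : R := alpha + eps.
have alpha0 : 0 < alpha by lra.
pose c := Num.truncn (3 / (2 * alpha - 1)).
pose K : R := 5 + expR 1.
apply: (@cvg_to_1 _ _ 1 K) => //.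
  by move=> n; apply/Gnp_prob_le1/powRN_prob; lra.
(* the constant of the lower bound for q below: 2 ^ 8 from the factors 1/4 in a
   and in the probability of joining, and 8 ^ 3 from m >= n / 8; it is kept
   abstract so that arithmetic tactics do not expand it *)
have [W W0 WE] : exists2 W : R, 0 < W & W = 2 ^+ 17.
  by exists (2 ^+ 17); rewrite ?exprn_gt0.
have near0 := nbhs_infty_ge 8.
have near1 : \forall n \near \oo, 2 <= (n%:R `^ alpha : R) by apply: near_powR_ge.
have near2 : \forall n \near \oo,
    (12 + 2 * c%:R) * (4 * W) * n%:R `^ beta <= (n%:R `^ (3 - 4 * alpha) : R).
  by apply: near_powR_le; rewrite /beta /eps; lra.
have near3 : \forall n \near \oo, 10 * ln n%:R <= (n%:R `^ eps : R).
  by apply: near_ln_le; rewrite /eps; lra.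
have near4 : \forall n \near \oo, 4 * n%:R `^ (1 - alpha) <= (n%:R `^ (1 / 2) : R).
  by apply: near_powR_le; lra.
have near5 : \forall n \near \oo, expR (- (1 / 4 * n%:R `^ (1 / 2))) <= (n%:R `^ (- 2) : R).
  by apply: near_expR_le; lra.
have near6 : \forall n \near \oo, expR (- (1 / 32 * n%:R `^ (1 - alpha))) <= (n%:R `^ (- 3) : R).
  by apply: near_expR_le; lra.
have near7 : \forall n \near \oo,
    expR (- (1 / (4 * W) * n%:R `^ (3 - 4 * alpha))) <= (n%:R `^ (- 3) : R).
  by apply: near_expR_le; [lra|rewrite divr_gt0 // mulr_gt0].
apply: filterS (filterI near0 (filterI near1 (filterI near2 (filterI near3
  (filterI near4 (filterI near5 (filterI near6 near7))))))) => n.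
move=> {near0 near1 near2 near3 near4 near5 near6 near7}.
move=> [n8 [near1 [near2 [near3 [near4 [near5 [near6 near7]]]]]]].
have n0 : (0 < n)%N by apply: leq_trans n8.
set N : R := n%:R.
have N0 : 0 < N by rewrite ltr0n.
have N1 : 1 <= N by rewrite ler1n.
set L := ln N.
have L0 : 0 <= L by apply: ln_ge0.
have NL : N = expR L by rewrite lnK // posrE.
set p := N `^ (- alpha).
have p0 : 0 < p by apply: powR_gt0.
have NM x y : N `^ (x + y) = N `^ x * N `^ y by apply: powRD_nat.
have Nle1 x : x <= 0 -> N `^ x <= 1.
  by move=> x0; have := ler_powR N1 x0; rewrite powRr0.
have Nge1 x : 0 <= x -> 1 <= N `^ x.
  by move=> x0; have := ler_powR N1 x0; rewrite powRr0.
have Nr1 : N `^ 1 = N by rewrite powRr1 // ltW.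
have p2 : p <= 2^-1.
  rewrite /p powRN lef_pV2 ?posrE ?powR_gt0 //.
pose h := (Num.truncn (N `^ beta)).+1.
pose D := Num.truncn (N `^ (1 / 2)).
pose m := (n %/ 4)%N.
pose a := m%:R * p / 4.
pose q := m%:R * ((a * p / 4) * (a * p / 4)).
pose s := N `^ (2 * alpha - 1).
have hlow : N `^ beta <= h%:R by rewrite ltW // truncnS_gt.
have hup : h%:R <= N `^ beta + 1.
  by rewrite -natr1 lerD2r truncn_le // powR_ge0.
have Dup : D%:R <= N `^ (1 / 2) by rewrite truncn_le // powR_ge0.
have Dlow : N `^ (1 / 2) <= D.+1%:R by rewrite ltW // truncnS_gt.
have clow : 3 <= (2 * alpha - 1) * c.+1%:R.
  rewrite mulrC -ler_pdivrMr; last by move: al; clear; lra.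
  by rewrite ltW // truncnS_gt.
have mup : m%:R <= N by rewrite ler_nat leq_div.
have mlow : N / 8 <= m%:R.
  by rewrite ler_pdivrMr // -natrM ler_nat; have [] := quarter_bounds n8.
have m0 : 0 < m%:R :> R by apply: lt_le_trans mlow; rewrite divr_gt0.
have s0 : 0 <= s by apply: powR_ge0.
have a0 : 0 <= a by rewrite divr_ge0 // mulr_ge0 // ltW.
have sN : s * (N * (p * p)) = 1.
  rewrite -{1}Nr1 /s /p -!NM.
  have -> : 2 * alpha - 1 + (1 + (- alpha - alpha)) = 0 by ring.
  by rewrite powRr0.
have ap : a * p <= 2.
  have this : N * (p * p) <= 1.
    by rewrite -{1}Nr1 /p -!NM; apply: Nle1; move: al; clear; lra.
  by rewrite /a; move: p0 mup this; clear; nra.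
have qlow : N `^ (3 - 4 * alpha) / W <= q.
  rewrite WE.
  have -> : N `^ (3 - 4 * alpha) = N ^+ 3 * (p ^+ 2) ^+ 2.
    have -> : 3 - 4 * alpha = (1 + (1 + 1)) + ((- alpha - alpha) + (- alpha - alpha)) by ring.
    by rewrite !NM Nr1 -/p; ring.
  have -> : q = m%:R ^+ 3 * (p ^+ 2) ^+ 2 / 2 ^+ 8 by rewrite /q /a; field.
  have -> : N ^+ 3 * (p ^+ 2) ^+ 2 / 2 ^+ 17 = (N / 8) ^+ 3 * (p ^+ 2) ^+ 2 / 2 ^+ 8.
    by field.
  rewrite ler_wpM2r // ?invr_ge0 ?exprn_ge0 // ler_wpM2r ?exprn_ge0 ?(ltW p0) //.
  by rewrite lerXn2r // nnegrE ?ler0n // divr_ge0 // ltW.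
pose t := q / 4.
have b1 : (3 * (h + h) + 2 * (c * D))%:R <= t.
  have b12 : N `^ (1 / 2) <= N `^ beta by apply: ler_powR => //; rewrite /beta /eps; move: ar; clear; lra.
  have b1 : 1 <= N `^ beta by apply: Nge1; rewrite /beta /eps; move: ar; clear; lra.
  have big := near2.
  have c0 : 0 <= c%:R :> R by [].
  have cD : c%:R * D%:R <= c%:R * N `^ beta by rewrite ler_wpM2l //; move: Dup b12; clear; lra.
  have big' : (12 + 2 * c%:R) * N `^ beta <= N `^ (3 - 4 * alpha) / W / 4.
    by rewrite -mulrA -invfM ler_pdivlMr ?mulr_gt0 // mulrAC [W * 4]mulrC.
  rewrite natrD !natrM natrD.
  apply: (@le_trans _ _ ((12 + 2 * c%:R) * N `^ beta)).
    by move: hup b1 b12 cD Dup c0; clear; nra.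
  by rewrite /t; move: qlow big'; clear; lra.
have := @reconstructable_sparse R n p h c D m a t s _ s0 a0 ap _ b1.
rewrite p2 (ltW p0) => /(_ isT) H; apply: le_trans (H _); last by have [] := quarter_bounds n8.
rewrite lerD2l lerN2.
have Nm1 : N `^ (- 1) = N^-1 by rewrite powRN Nr1.
have eNm1 : expR (- L) = N^-1 by rewrite expRN -NL.
have F1 : N ^+ (4 * h) * expR (- ((h * h)%:R * p / 2)) <= N^-1.
  rewrite {1}NL -expRM_natl -expRD -eNm1 ler_expR.
  have hp : N `^ eps <= h%:R * p.
    have -> : N `^ eps = N `^ beta * p by rewrite -NM /beta; congr (_ `^ _); ring.
    by rewrite ler_wpM2r // ltW.
  have big : 10 * L <= N `^ eps := near3.
  have h1 : 1 <= h%:R :> R by rewrite ler1n.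
  rewrite !natrM; move: (le_trans big hp) h1 L0; clear.
  by move: (h%:R : R) => x; nra.
have F2 : (n * n)%:R * (expR (s * (N * (p * p))) / (1 + s) ^+ c.+1) <= expR 1 * N^-1.
  rewrite natrM; apply: codegree_term_le => //.
  rewrite -powR_mulrn // /s -powRrM -[X in X * X * X]Nr1 -!NM.
  by apply: ler_powR => //; move: clow; clear; lra.
have F3 : N * (expR (N * p) / 2 ^+ D.+1) <= N^-1.
  have NNp : N * p = N `^ (1 - alpha) by rewrite NM Nr1.
  apply: (@le_trans _ _ (N * (expR (N * p) / expR (N `^ (1 / 2) / 2)))).
    rewrite ler_wpM2l ?(ltW N0) // ler_wpM2l ?expR_ge0 //.
    by rewrite lef_pV2 ?posrE ?expR_gt0 ?exprn_gt0 // expR_half_le_exp2.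
  rewrite -expRN -expRD NNp.
  apply: (@le_trans _ _ (N * N `^ (- 2))).
    rewrite ler_wpM2l ?(ltW N0) //; apply: le_trans near5; rewrite ler_expR -/N.
    by move: near4; rewrite -/N; clear; lra.
  rewrite -{1}Nr1 -NM -Nm1 le_eqVlt; apply/orP; left; apply/eqP; congr (_ `^ _).
  by clear; ring.
have F4 : (n * n)%:R * (2 * expR (a - m%:R * p / 2) + expR (t - q / 2)) <= 3 * N^-1.
  have N3 : N * N * N `^ (- 3) = N^-1.
    rewrite -[X in X * X * _]Nr1 -!NM -Nm1; congr (_ `^ _); ring.
  have NNp : N * p = N `^ (1 - alpha) by rewrite NM Nr1.
  have e1 : expR (a - m%:R * p / 2) <= N `^ (- 3).
    apply: le_trans near6; rewrite ler_expR -/N -NNp /a; move: mlow p0; clear; nra.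
  have e2 : expR (t - q / 2) <= N `^ (- 3).
    apply: le_trans near7; rewrite ler_expR -/N /t.
    have -> : 1 / (4 * W) * N `^ (3 - 4 * alpha) = N `^ (3 - 4 * alpha) / W / 4.
      by rewrite invfM; ring.
    by move: qlow; clear; lra.
  rewrite natrM -/N -N3.
  have NN : 0 <= N * N by rewrite mulr_ge0 // ltW.
  by move: NN e1 e2; clear; nra.
apply: le_trans (lerD (lerD (lerD F1 F2) F3) F4) _.
rewrite Nm1 /K; move: (N^-1) (expR 1) => x y; clear.
by rewrite le_eqVlt; apply/orP; left; apply/eqP; ring.
Qed.

(** The thinning bound with [l] near [n p / 4] makes two degrees equal with
    probability of order [(n p)^(-1/4)], at most [n^(-1/8)] up to a constant.
    So degree classes of size [M = n^(31/32)] are excluded up to an error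
    [n^2 n^(-1/8) / M^2 = n^(-1/16)], while [Q] is of order [p M], which leaves
    [n / M = n^(1/32)] in the exponent of the bound on equal invariants. *)
Lemma separated_whp (R : realType) (alpha : R) : 0 < alpha < 1 / 2 ->
  (fun n : nat => Gnp_prob (n%:R `^ (- alpha))
      (fun G : sgraph 'I_n => separated G)) @ \oo --> (1 : R).
Proof.
move=> /andP[alpha0 ar].
apply: (@cvg_to_1 _ _ (1 / 16) 8); first by lra.
  by move=> n; apply/Gnp_prob_le1/powRN_prob.
have near0 := nbhs_infty_ge 4.
have near1 : \forall n \near \oo, 2 <= (n%:R `^ alpha : R) by apply: near_powR_ge.
have near2 : \forall n \near \oo, 2 <= (n%:R `^ (31 / 32) : R).
  by apply: near_powR_ge; lra.
have near3 : \forall n \near \oo,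
    expR (- (1 / 4 * n%:R `^ (1 - 2 * alpha))) <= (n%:R `^ (- 3) : R).
  by apply: near_expR_le; lra.
have near4 : \forall n \near \oo,
    expR (- (1 / 4 * n%:R `^ (1 - alpha))) <= (n%:R `^ (- 1) : R).
  by apply: near_expR_le; lra.
have near5 : \forall n \near \oo,
    expR (- (1 / 25 * n%:R `^ (1 / 32))) <= (n%:R `^ (- 3) : R).
  by apply: near_expR_le; lra.
apply: filterS (filterI near0 (filterI near1 (filterI near2 (filterI near3
  (filterI near4 near5))))) => n.
move=> {near0 near1 near2 near3 near4 near5}.
move=> [n4 [near1 [near2 [near3 [near4 near5]]]]].
have n0 : (0 < n)%N by apply: leq_trans n4.
have n2 : (2 <= n)%N by apply: leq_trans n4.
set N : R := n%:R.
have N0 : 0 < N by rewrite ltr0n.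
have N1 : 1 <= N by rewrite ler1n.
have N4 : 4 <= N by rewrite ler_nat.
set p := N `^ (- alpha).
have p0 : 0 < p by apply: powR_gt0.
have NM x y : N `^ (x + y) = N `^ x * N `^ y by apply: powRD_nat.
have Nge1 x : 0 <= x -> 1 <= N `^ x.
  by move=> x0; have := ler_powR N1 x0; rewrite powRr0.
have Npos x : 0 < N `^ x by apply: powR_gt0.
have Nr1 : N `^ 1 = N by rewrite powRr1 // ltW.
have p2 : p <= 2^-1.
  by rewrite /p powRN lef_pV2 ?posrE ?powR_gt0.
pose x := N `^ (31 / 32).
pose M := (Num.truncn x).+1.
pose y := N `^ (1 - alpha).
pose l := Num.truncn (y / 4).
pose d : R := 2 * N `^ (- ((1 - alpha) / 4)).
pose Q : R := 1 + 12 * p * M%:R.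
have x2 : 2 <= x by exact: near2.
have y0 : 0 < y by exact: Npos.
have M1 : (1 < M)%N by rewrite ltnS truncn_gt0; lra.
have Mlow : x <= M%:R by rewrite ltW // truncnS_gt.
have Mup : M%:R <= x + 1.
  by rewrite -natr1 lerD2r truncn_le // powR_ge0.
have Mp : M.-1%:R = M%:R - 1 :> R by rewrite -[M in RHS](prednK (ltnW M1)) -natr1 addrK.
have llow : y / 4 <= l.+1%:R by rewrite ltW // truncnS_gt.
have lup : l%:R <= y / 4 by rewrite truncn_le divr_ge0 // ltW.
have d0 : 0 <= d by rewrite mulr_ge0 // ltW.
have dl : 1 <= d ^+ 4 * l.*2.+1%:R.
  have d4 : d ^+ 4 * y = 16.
    rewrite /d exprMn -[(N `^ _) ^+ 4]powR_mulrn ?powR_ge0 // -powRrM /y -mulrA -NM.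
    have -> : - ((1 - alpha) / 4) * 4 + (1 - alpha) = 0 by field.
    by rewrite powRr0 mulr1 -natrX.
  have ll : l.+1%:R <= l.*2.+1%:R :> R by rewrite ler_nat ltnS -addnn leq_addr.
  have d40 : 0 <= d ^+ 4 by apply: exprn_ge0.
  by move: d4 d40 (le_trans llow ll); clear; move: (d ^+ 4) (l.*2.+1%:R) => a b; nra.
have pp : 0 <= p <= 2^-1 by rewrite p2 ltW.
apply: le_trans (@separated_dense R n p l M d Q pp d0 dl M1 (lexx _) n2).
rewrite lerD2l lerN2.
have Nm1 : N `^ (- 1) = N^-1 by rewrite powRN Nr1.
have N3 : N * N * N `^ (- 3) = N `^ (- 1).
  by rewrite -[X in X * X * _]Nr1 -!NM; congr (_ `^ _); ring.
have Nm16 : N `^ (- 1) <= N `^ (- (1 / 16)) by apply: ler_powR => //; clear; lra.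
have NN0 : 0 <= N * N by rewrite mulr_ge0 // ltW.
have F1 : (n * n)%:R * expR (- ((n%:R - 2) * (p * p) / 2)) <= N `^ (- (1 / 16)).
  rewrite natrM -/N; apply: le_trans Nm16; rewrite -N3 ler_wpM2l //.
  apply: le_trans near3; rewrite ler_expR lerN2 -/N.
  have -> : 1 - 2 * alpha = 1 + (- alpha - alpha) by ring.
  rewrite !NM Nr1 -/p; have ppos : 0 < p * p by rewrite mulr_gt0.
  by move: N4 ppos; clear; move: (p * p) => z; nra.
have F2 : (n * n)%:R * (2 ^+ l * (1 - p) ^+ (n - 2) + d) / (M * M.-1)%:R <=
    6 * N `^ (- (1 / 16)).
  have e1 : 2 ^+ l * (1 - p) ^+ (n - 2) <= N `^ (- (1 / 8)).
    apply: (@le_trans _ _ (N `^ (- 1))); last by apply: ler_powR => //; clear; lra.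
    apply: le_trans near4; rewrite -/N -/y.
    apply: (@le_trans _ _ (expR l%:R * expR (- (p * (n - 2)%:R)))).
      apply: ler_pM; rewrite ?exprn_ge0 ?subr_ge0 //.
      - by move: p2; clear; lra.
      - rewrite -[l%:R]mulr1 expRM_natl lerXn2r ?nnegrE ?expR_ge0 //.
        exact: (expR_ge1Dx 1).
      - rewrite -mulNr expRM_natr lerXn2r ?nnegrE ?expR_ge0 ?expR_ge1Dx // subr_ge0.
        by move: p2; clear; lra.
    rewrite -expRD ler_expR natrB // -/N.
    have yE : y = N * p by rewrite /y NM Nr1.
    by move: lup N4 p0; rewrite yE; clear; nra.
  have e2 : d <= 2 * N `^ (- (1 / 8)).
    by rewrite ler_wpM2l //; apply: ler_powR => //; move: ar; clear; lra.
  have e3 : x * x / 2 <= (M * M.-1)%:R.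
    by rewrite natrM Mp; move: Mlow x2; clear; nra.
  have xx0 : 0 < x * x / 2 by rewrite divr_gt0 // mulr_gt0 ?Npos.
  rewrite ler_pdivrMr; last exact: lt_le_trans xx0 e3.
  rewrite natrM -/N.
  apply: (@le_trans _ _ (N * N * (3 * N `^ (- (1 / 8))))).
    apply: ler_wpM2l => //.
    have -> : 3 * N `^ (- (1 / 8)) = N `^ (- (1 / 8)) + 2 * N `^ (- (1 / 8)) by ring.
    exact: lerD.
  have e4 : N * N * N `^ (- (1 / 8)) = N `^ (- (1 / 16)) * (x * x).
    by rewrite /x -!NM -[X in X * X * _]Nr1 -!NM; congr (_ `^ _); field.
  have -> : N * N * (3 * N `^ (- (1 / 8))) = 6 * N `^ (- (1 / 16)) * (x * x / 2).
    by rewrite mulrCA e4; field.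
  by rewrite ler_wpM2l // mulr_ge0 // powR_ge0.
have F3 : (n * n)%:R * expR (- (2 * p * (n - 2)%:R / Q)) <= N `^ (- (1 / 16)).
  rewrite natrM -/N; apply: le_trans Nm16; rewrite -N3 ler_wpM2l //.
  apply: le_trans near5; rewrite ler_expR lerN2 -/N natrB // -/N.
  have px : 1 <= p * x by rewrite /p /x -NM; apply: Nge1; move: ar; clear; lra.
  have Qup : Q <= 25 * (p * x).
    by rewrite /Q; move: px Mup x2 p0; clear; nra.
  have Q0 : 0 < Q.
    by rewrite /Q; apply: addr_gt0 => //; rewrite !mulr_gt0 // ltr0n.
  have Nx : N = x * N `^ (1 / 32) by rewrite /x -NM -[LHS]Nr1; congr (_ `^ _); field.
  rewrite ler_pdivlMr //.
  apply: (@le_trans _ _ (1 / 25 * N `^ (1 / 32) * (25 * (p * x)))).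
    by rewrite ler_wpM2l // mulr_ge0 // powR_ge0.
  have -> : 1 / 25 * N `^ (1 / 32) * (25 * (p * x)) = p * N by rewrite [in RHS]Nx; field.
  by move: N4 p0; clear; nra.
apply: le_trans (lerD (lerD F1 F2) F3) _.
by move: (N `^ _) => z; clear; lra.
Qed.

Lemma Gnp_prob_mono (R : realType) (n : nat) (p : R) (E E' : sgraph 'I_n -> Prop) :
  0 <= p <= 1 -> (forall G, E G -> E' G) -> Gnp_prob p E <= Gnp_prob p E'.
Proof.
move=> p01 EE'; rewrite !Gnp_probE; apply: le_Pr; first exact: slot_prob01.
by move=> w /asboolP /EE' ?; apply/asboolP.
Qed.

Lemma cvg_Gnp_prob_mono (R : realType) (alpha : R)
    (E E' : forall n, sgraph 'I_n -> Prop) :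
  0 < alpha -> (forall n G, @E n G -> @E' n G) ->
  (fun n => Gnp_prob (n%:R `^ (- alpha)) (@E n)) @ \oo --> (1 : R) ->
  (fun n => Gnp_prob (n%:R `^ (- alpha)) (@E' n)) @ \oo --> (1 : R).
Proof.
move=> a0 EE' cE; apply: squeeze_cvgr cE (@cvg_cst _ (1 : R) nat \oo _).
near=> n; have p01 := powRN_prob n a0.
by rewrite (Gnp_prob_mono p01 (EE' n)) (Gnp_prob_le1 _ p01).
Unshelve. all: by end_near. Qed.

Theorem theorem4 (R : realType) (alpha : R)
  (halpha : 0 < alpha < 1 / 2 \/ 1 / 2 < alpha < 3 / 5) :
  ((fun n : nat => Gnp_prob (n%:R `^ (- alpha))
      (fun G : sgraph 'I_n => exactly_reconstructable 2 G))
     @ \oo --> (1 : R)) /\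
  (alpha < 1 / 2 ->
   exists P : cmd,
     polytime_on_nbhds 2 P /\
     ((fun n : nat => Gnp_prob (n%:R `^ (- alpha))
         (fun G : sgraph 'I_n => reconstructs 2 P G))
        @ \oo --> (1 : R))).
Proof.
case: halpha => [adense|asparse]; last first.
  by split=> [|a2]; [exact: reconstructable_sparse_whp|move: asparse; lra].
have [a0 _] := andP adense; have sep := separated_whp adense.
split=> [|_].
  by apply: cvg_Gnp_prob_mono a0 _ sep => n G; apply: separated_reconstructable.
exists program; split; first exact: program_polytime.
by apply: cvg_Gnp_prob_mono a0 _ sep => n G; apply: program_reconstructs.
Qed.
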